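(* Let $H$ be a complex Hilbert space and let $(T(t))_{t\ge 0}$ be a $C_0$-semigroup on $H$ with infinitesimal generator $A$. Assume that $A$ satisfies the generalized Kreiss condition, that is, the open right half-plane $\mathbb{C}^{+}=\{\lambda\in\mathbb{C}:\operatorname{Re}\lambda>0\}$ is contained in the resolvent set $\rho(A)$ and there is a non-decreasing function $g:(0,\infty)\to(0,\infty)$ such that $$\|R(\lambda,A)\|\le g\Big(\frac{1}{\operatorname{Re}\lambda}\Big)\quad\text{for all }\lambda\in\mathbb{C}^{+}.$$ Define $$\Lambda(t)=\int_{2}^{t}\frac{s}{[g(s)]^2}\,ds,\qquad t>2.$$ Then, as $t\to\infty$, $$\|T(t)\|=O\left(\frac{g(t)}{\sqrt{\Lambda(t)}}\right).$$
   Context: $R(\lambda,A)=(\lambda-A)^{-1}$ denotes the resolvent operator of $A$ at $\lambda\in\rho(A)$, and $\|\cdot\|$ applied to operators is the operator norm on $H$. For two positive functions $f_1,f_2$ defined in a neighborhood of $+\infty$, $f_1(t)=O(f_2(t))$ means that there is a constant $c>0$ such that $f_1(t)\le c f_2(t)$ for every $t>0$ sufficiently large. *)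

(* Defs.v *)
From Stdlib Require Import Reals Lra.
From Coquelicot Require Import Coquelicot.
Open Scope R_scope.

(* Positivity and definiteness of the inner product follow from [inner_norm]
   and the corresponding properties of the norm. *)
Record HilbertSpace : Type := {
  hilbert_module :> CompleteNormedModule C_AbsRing;
  inner : hilbert_module -> hilbert_module -> C;
  inner_plus_l : forall x y z : hilbert_module,
    inner (plus x y) z = Cplus (inner x z) (inner y z);
  inner_scal_l : forall (a : C) (x y : hilbert_module),
    inner (scal a x) y = Cmult a (inner x y);
  inner_conj : forall x y : hilbert_module, inner y x = Cconj (inner x y);
  inner_norm : forall x : hilbert_module, inner x x = RtoC (norm x ^ 2)
}.

Section Operators.

Context {V : NormedModule C_AbsRing}.

Definition unit_ball_image (L : V -> V) (r : R) : Prop :=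
  exists x : V, norm x <= 1 /\ r = norm (L x).

(* [real] sends infinite values to 0; by [op_norm_lub] this does not happen for
   bounded operators ([is_linear] includes boundedness), the only ones to which
   [op_norm] is applied. *)
Definition op_norm (L : V -> V) : R := real (Lub_Rbar (unit_ball_image L)).

Lemma op_norm_lub (L : V -> V) :
  is_linear L -> is_lub (unit_ball_image L) (op_norm L).
Proof.
intros [_ _ [M [HM HL]]].
assert (Hub : is_ub_Rbar (unit_ball_image L) (Finite M)).
{ intros r [x [Hx ->]]; simpl.
  apply Rle_trans with (1 := HL x).
  rewrite <- (Rmult_1_r M) at 2.
  apply Rmult_le_compat_l; lra. }
unfold op_norm.
destruct (Lub_Rbar_correct (unit_ball_image L)) as [H1 H2].
specialize (H2 _ Hub) as H3.
assert (H0 : Rbar_le (Finite (norm (L zero))) (Lub_Rbar (unit_ball_image L))).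
{ apply H1; exists zero; split; [rewrite norm_zero; lra | reflexivity]. }
destruct (Lub_Rbar (unit_ball_image L)) as [l | |]; simpl in *; try easy.
split.
- intros r Hr; exact (H1 r Hr).
- intros b Hb; apply (H2 (Finite b)); intros r Hr; exact (Hb r Hr).
Qed.

(* Only the values [T t] with [0 <= t] are meaningful. *)
Record C0_semigroup (T : R -> V -> V) : Prop := {
  semigroup_linear : forall t : R, 0 <= t -> is_linear (T t);
  semigroup_0 : forall x : V, T 0 x = x;
  semigroup_plus : forall (s t : R) (x : V),
    0 <= s -> 0 <= t -> T (s + t) x = T s (T t x);
  semigroup_continuous : forall x : V,
    filterlim (fun t => T t x) (at_right 0) (locally x)
}.

(* Unbounded operators are given by their graphs: [A x y] means that x is in
   the domain of A and A x = y. *)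
Definition generator (T : R -> V -> V) (x y : V) : Prop :=
  filterlim (fun h : R => scal (RtoC (/ h)) (minus (T h x) x))
    (at_right 0) (locally y).

(* The graph of lambda - A. *)
Definition scalar_minus (lambda : C) (A : V -> V -> Prop) (x y : V) : Prop :=
  exists z : V, A x z /\ y = minus (scal lambda x) z.

(* lambda - A is a bijection from the domain of A onto V, and its inverse is
   the bounded operator Q. *)
Definition is_resolvent (A : V -> V -> Prop) (lambda : C) (Q : V -> V) : Prop :=
  is_linear Q /\ forall x y : V, Q y = x <-> scalar_minus lambda A x y.

Definition resolvent_set (A : V -> V -> Prop) (lambda : C) : Prop :=
  exists Q : V -> V, is_resolvent A lambda Q.

Definition generalized_Kreiss (A : V -> V -> Prop) (g : R -> R) : Prop :=
  (forall lambda : C, 0 < Re lambda -> resolvent_set A lambda) /\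
  (forall (lambda : C) (Q : V -> V), 0 < Re lambda ->
     is_resolvent A lambda Q -> op_norm Q <= g (1 / Re lambda)).

End Operators.

Definition Lambda (g : R -> R) (t : R) : R :=
  RInt (fun s => s / (g s) ^ 2) 2 t.

Definition bigO_infty (f1 f2 : R -> R) : Prop :=
  exists c : R, 0 < c /\ exists t0 : R, forall t : R, t0 < t -> f1 t <= c * f2 t.

(* Main.v *)
Require Import Defs.
From Stdlib Require Import Reals Lra Lia Psatz Classical ClassicalEpsilon.
From Coquelicot Require Import Coquelicot.
From Corelib Require Import ssreflect.
Open Scope R_scope.

(** In continuous time the argument runs as follows.  Fix [a] above the growth
    bound of the semigroup, and compare the resolvent on the line of abscissa
    [delta = 1/t] with the resolvent on the line of abscissa [a]: by the resolvent
    identity and the Kreiss condition they differ by a factor [1 + a g(t)].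
    Plancherel's theorem turns this into the square function estimate

      int_0^t |T(s) x|^2 ds <= C g(t)^2 |x|^2

    and, for the adjoint semigroup, into a bound of [|int_0^s T(r) f(r) dr|^2] by
    [C g(s)^2 int_0^s |f|^2].  Writing [T(t) x] as the mean, for [r] from [s] to [2s], of
    [T(r) T(t-r) x] and using the second estimate,

      s^2 |T(t) x|^2 <= C g(2s)^2 int_s^(2s) |T(t-r) x|^2 dr .

    After division by [s g(2s)^2] and integration in [s], the left side becomes
    [Lambda(t) |T(t) x|^2] up to a constant.  On the right each [r] is counted with
    total weight [int_(r/2)^r ds/s = ln 2], which leaves the square function
    estimate at time [t].  The restriction to [r] between [s] and [2s] is what makes
    this weight bounded.

    Everything is carried out on the implicit Euler scheme.  Its step
    [J = (1 - h A)^-1 = R(1/h, A)/h] is a bounded operator, and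
    [J (1 - z J)^-1 = R((1-z)/h, A)/h], so the Kreiss condition bounds the resolvent
    of [J] outside the closed unit disc ([euler_step_resolvent_bound]).  For a bounded
    operator Plancherel's theorem reduces to Parseval's identity on a finite
    cyclic group ([parseval], [cyclic_estimate]), after a limit in the length of
    the period ([evolution_estimate]) that is justified by
    [resolvent_bound_power_decay].  The comparison of two lines becomes that of two
    circles ([orbit_transfer] and its dual [evolution_transfer]); their distance is
    proportional to [h], which compensates the factor [1/h] in the resolvent of [J],
    so that all constants are uniform in [h] ([radius_facts]).  The result is
    [euler_power_Lambda], a bound for [J^n x] with [n h = t].

    It remains to let [h] tend to [0].  In the equivalent norm [renorm] the
    semigroup grows at most like [exp (w t)], so the scheme is stable
    ([renorm_euler_step]); it is consistent on the domain of [A], and this domain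
    is dense because [J x] tends to [x] ([euler_step_near_identity]).  Hence
    [J^n x] converges to [T(t) x] ([euler_converges]). *)

(** * Vectors and inner products *)

Lemma norm_scal_C (V : NormedModule C_AbsRing) (a : C) (x : V) :
  norm (scal a x) = Cmod a * norm x.
Proof.
apply Rle_antisym; first exact (norm_scal a x).
destruct (Req_dec (Cmod a) 0) as [Ha | Ha].
{ rewrite Ha Rmult_0_l; apply norm_ge_0. }
assert (Ha0 : a <> RtoC 0) by (intros E; apply Ha; rewrite E; exact Cmod_0).
assert (Hx : x = scal (Cinv a) (scal a x)).
{ rewrite scal_assoc.
  change (x = scal (Cmult (Cinv a) a) x).
  rewrite Cinv_l //. symmetry; exact (scal_one x). }
assert (Hn : norm x <= Cmod (Cinv a) * norm (scal a x)).
{ rewrite {1}Hx. exact (norm_scal (Cinv a) (scal a x)). }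
rewrite Cmod_inv // in Hn.
assert (Hp := Cmod_ge_0 a).
apply Rmult_le_compat_l with (r := Cmod a) in Hn; last lra.
rewrite -Rmult_assoc Rinv_r // Rmult_1_l in Hn.
exact Hn.
Qed.

Section Hilbert.

Context {H : HilbertSpace}.
Implicit Types x y z : H.

Lemma norm_scal_R (a : R) x : norm (scal (RtoC a) x) = Rabs a * norm x.
Proof. by rewrite norm_scal_C Cmod_R. Qed.

Lemma vnorm_triangle x y : norm (plus x y) <= norm x + norm y.
Proof. exact (norm_triangle (V := H) x y). Qed.

Lemma vnorm_opp x : norm (opp x) = norm x.
Proof. exact (norm_opp (V := H) x). Qed.

Lemma vnorm_minus x y : norm (minus x y) <= norm x + norm y.
Proof. rewrite /minus -(vnorm_opp y). apply vnorm_triangle. Qed.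

Lemma inner_plus_r x y z : inner H x (plus y z) = Cplus (inner H x y) (inner H x z).
Proof.
rewrite (inner_conj H (plus y z) x) inner_plus_l Cplus_conj.
by rewrite -!inner_conj.
Qed.

Lemma inner_scal_r (a : C) x y : inner H x (scal a y) = Cmult (Cconj a) (inner H x y).
Proof.
rewrite (inner_conj H (scal a y) x) inner_scal_l Cmult_conj.
by rewrite -!inner_conj.
Qed.

Lemma inner_opp_l x y : inner H (opp x) y = Copp (inner H x y).
Proof.
assert (E : opp x = scal (Copp (RtoC 1)) x) by (symmetry; exact (scal_opp_one x)).
rewrite E inner_scal_l. ring.
Qed.

Lemma inner_zero_l y : inner H zero y = RtoC 0.
Proof.
assert (E : zero = scal (RtoC 0) (zero : H)) by (symmetry; exact (scal_zero_r (RtoC 0))).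
rewrite E inner_scal_l. ring.
Qed.

Lemma inner_ext x y : (forall z, inner H x z = inner H y z) -> x = y.
Proof.
intros E.
assert (Hz : minus x y = zero).
{ apply (norm_eq_zero (V := H)).
  assert (Hi : RtoC (norm (minus x y) ^ 2) = RtoC 0).
  { rewrite -inner_norm {1}/minus inner_plus_l inner_opp_l E. ring. }
  apply RtoC_inj in Hi. apply Rsqr_eq_0. unfold Rsqr. lra. }
apply (f_equal (fun w => plus w y)) in Hz.
by rewrite /minus -plus_assoc plus_opp_l plus_zero_r plus_zero_l in Hz.
Qed.

End Hilbert.

(** Two vectors coincide when all their inner products do, which turns an
    identity between linear combinations into one in the field of complex
    numbers. *)
Ltac vector_expand :=
  apply inner_ext; let z := fresh in intros z;
  rewrite /minus ?(inner_plus_l, inner_scal_l, inner_opp_l, inner_zero_l);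
  rewrite ?(RtoC_plus, RtoC_mult, RtoC_minus, RtoC_opp).
Ltac C_ring := match goal with |- ?a = ?b => change (@eq C a b) end; ring.

Ltac C_field := match goal with |- ?a = ?b => change (@eq C a b) end; field.
Ltac vector_ring := vector_expand; C_ring.

Lemma vnorm_split (H : HilbertSpace) (x y : H) : norm x <= norm (minus x y) + norm y.
Proof.
assert (E : x = plus (minus x y) y) by vector_ring.
rewrite {1}E. apply vnorm_triangle.
Qed.

Lemma RtoC_neq0 (a : R) : a <> 0 -> RtoC a <> RtoC 0.
Proof. intros Ha E; apply Ha, RtoC_inj, E. Qed.
(** * Finite Fourier transform *)

Definition cis (t : R) : C := (cos t, sin t).

Lemma cis_plus (s t : R) : cis (s + t) = Cmult (cis s) (cis t).
Proof.
rewrite /cis /Cmult cos_plus sin_plus /=.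
apply injective_projections; simpl; ring.
Qed.

Lemma cis_0 : cis 0 = RtoC 1.
Proof. by rewrite /cis cos_0 sin_0. Qed.

Lemma cis_conj (t : R) : Cconj (cis t) = cis (- t).
Proof. by rewrite /cis /Cconj /= cos_neg sin_neg. Qed.

Lemma Cmod_cis (t : R) : Cmod (cis t) = 1.
Proof.
rewrite /Cmod /cis /=.
replace (cos t * (cos t * 1) + sin t * (sin t * 1)) with 1; first exact sqrt_1.
generalize (sin2_cos2 t); unfold Rsqr; lra.
Qed.

Lemma cis_nat (n : nat) (t : R) : cis (INR n * t) = Cpow (cis t) n.
Proof.
induction n as [|n IH].
- by rewrite Rmult_0_l cis_0.
- rewrite S_INR Rmult_plus_distr_r Rmult_1_l Rplus_comm cis_plus IH //.
Qed.

Lemma cis_period (n : nat) : cis (2 * PI * INR n) = RtoC 1.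
Proof.
rewrite /cis.
replace (2 * PI * INR n) with (0 + 2 * INR n * PI) by ring.
by rewrite cos_period sin_period cos_0 sin_0.
Qed.

Lemma cis_neq_1 (t : R) : 0 < Rabs t < 2 * PI -> cis t <> RtoC 1.
Proof.
assert (Hpos : forall s, 0 < s < 2 * PI -> cos s <> 1).
{ intros s Hs E.
  assert (Hs2 := cos_2a_sin (s / 2)).
  replace (2 * (s / 2)) with s in Hs2 by field.
  assert (0 < sin (s / 2)) by (apply sin_gt_0; lra).
  nra. }
intros Ht E.
assert (Ec : cos t = 1) by exact (f_equal fst E).
unfold Rabs in Ht. destruct (Rcase_abs t).
- apply (Hpos (- t)); [lra | by rewrite cos_neg].
- by apply (Hpos t).
Qed.

Lemma sum_n_Cpow (z : C) (N : nat) :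
  Cmult (sum_n (fun j => Cpow z j) N) (Cminus z (RtoC 1))
  = Cminus (Cpow z (S N)) (RtoC 1).
Proof.
induction N as [|N IH].
- rewrite sum_O /=. ring.
- rewrite sum_Sn.
  change (Cmult (Cplus (sum_n (fun j => Cpow z j) N) (Cpow z (S N))) (Cminus z (RtoC 1))
    = Cminus (Cpow z (S (S N))) (RtoC 1)).
  rewrite Cmult_plus_distr_r IH /=. ring.
Qed.

(** The character [n |-> exp (2 i pi j n / (N + 1))] of the cyclic group of
    order [N + 1]. *)
Definition character (N j n : nat) : C :=
  cis (2 * PI / INR (S N) * INR j * INR n).

Lemma character_orthogonal (N n m : nat) : (n <= N)%nat -> (m <= N)%nat ->
  sum_n (fun j => Cmult (character N j n) (Cconj (character N j m))) N
  = if Nat.eqb n m then RtoC (INR (S N)) else RtoC 0.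
Proof.
intros Hn Hm.
assert (HN : 0 < INR (S N)) by (apply lt_0_INR; lia).
set (t := 2 * PI / INR (S N) * (INR n - INR m)).
assert (E : forall j, Cmult (character N j n) (Cconj (character N j m)) = Cpow (cis t) j).
{ intros j. rewrite /character cis_conj -cis_plus -cis_nat.
  f_equal. unfold t. ring. }
rewrite (sum_n_ext _ _ N E).
destruct (Nat.eqb_spec n m) as [<- | Hnm].
- assert (Et : cis t = RtoC 1) by (rewrite /t Rminus_diag Rmult_0_r; exact cis_0).
  rewrite Et. clear -N.
  induction N as [|N IH]; first by rewrite sum_O.
  rewrite sum_Sn IH Cpow_1_l (S_INR (S N)) RtoC_plus //.
- assert (Ht : cis t <> RtoC 1).
  { apply cis_neq_1.
    assert (Hnm' : 1 <= Rabs (INR n - INR m) <= INR N).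
    { assert (Hn' := le_INR _ _ Hn). assert (Hm' := le_INR _ _ Hm).
      assert (Hn0 := pos_INR n). assert (Hm0 := pos_INR m).
      split; last (apply Rabs_le; lra).
      destruct (Nat.lt_total n m) as [h|[h|h]]; [|easy|];
      apply le_INR in h; rewrite S_INR in h;
      [rewrite Rabs_left | rewrite Rabs_right]; lra. }
    rewrite /t Rabs_mult (Rabs_right (2 * PI / INR (S N))).
    2: apply Rle_ge, Rlt_le, Rdiv_lt_0_compat; [generalize PI_RGT_0; lra | exact HN].
    assert (HP : 0 < 2 * PI / INR (S N)).
    { apply Rdiv_lt_0_compat; [generalize PI_RGT_0; lra | exact HN]. }
    split; first (apply Rmult_lt_0_compat; lra).
    replace (2 * PI) with (2 * PI / INR (S N) * INR (S N)) at 2 by (field; lra).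
    apply Rmult_lt_compat_l; [exact HP|]. rewrite S_INR; lra. }
  assert (HSN : Cpow (cis t) (S N) = RtoC 1).
  { rewrite -cis_nat.
    replace (INR (S N) * t) with (2 * PI * INR n + - (2 * PI * INR m)).
    2: unfold t; field; lra.
    rewrite cis_plus -cis_conj !cis_period /Cconj /Cmult /=.
    apply injective_projections; simpl; ring. }
  generalize (sum_n_Cpow (cis t) N); rewrite HSN => Hs.
  destruct (Ceq_dec (sum_n (fun j => Cpow (cis t) j) N) (RtoC 0)) as [E0 | Hne]; first exact E0.
  exfalso. apply (Cmult_neq_0 _ _ Hne (Cminus_eq_contra _ _ Ht)).
  rewrite Hs. ring.
Qed.

Lemma RtoC_sum (f : nat -> R) (N : nat) :
  RtoC (sum_f_R0 f N) = sum_n (fun k => RtoC (f k)) N.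
Proof.
induction N as [|N IH]; first by rewrite sum_O.
rewrite sum_Sn -IH /= RtoC_plus //.
Qed.

Lemma sum_n_delta (a : nat -> C) (n N : nat) : (n <= N)%nat ->
  sum_n (fun m => if Nat.eqb n m then a m else RtoC 0) N = a n.
Proof.
assert (Hz : forall N, (N < n)%nat ->
  sum_n (fun m => if Nat.eqb n m then a m else RtoC 0) N = RtoC 0).
{ clear N; induction N as [|N IH] => HN.
  - rewrite sum_O. destruct (Nat.eqb_spec n 0); [lia | easy].
  - rewrite sum_Sn IH; last lia.
    destruct (Nat.eqb_spec n (S N)); [lia | exact (Cplus_0_l (RtoC 0))]. }
induction N as [|N IH] => HN.
- rewrite sum_O. assert (n = 0)%nat by lia. subst. easy.
- rewrite sum_Sn. destruct (Nat.eqb_spec n (S N)) as [-> | Hne].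
  + rewrite Hz; last lia. exact (Cplus_0_l _).
  + rewrite IH; last lia. exact (Cplus_0_r _).
Qed.

Section Fourier.

Context {H : HilbertSpace}.

Lemma inner_sum_l (u : nat -> H) (y : H) (N : nat) :
  inner H (sum_n u N) y = sum_n (fun k => inner H (u k) y) N.
Proof.
induction N as [|N IH]; first by rewrite !sum_O.
by rewrite !sum_Sn inner_plus_l IH.
Qed.

Lemma inner_sum_r (u : nat -> H) (y : H) (N : nat) :
  inner H y (sum_n u N) = sum_n (fun k => inner H y (u k)) N.
Proof.
induction N as [|N IH]; first by rewrite !sum_O.
by rewrite !sum_Sn inner_plus_r IH.
Qed.

Definition dft (N : nat) (u : nat -> H) (j : nat) : H :=
  sum_n (fun n => scal (character N j n) (u n)) N.

Lemma parseval (N : nat) (u : nat -> H) :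
  sum_f_R0 (fun j => norm (dft N u j) ^ 2) N
  = INR (S N) * sum_f_R0 (fun n => norm (u n) ^ 2) N.
Proof.
apply RtoC_inj. rewrite RtoC_mult !RtoC_sum.
transitivity (sum_n (fun j => sum_n (fun n => sum_n (fun m =>
  Cmult (Cmult (character N j n) (Cconj (character N j m))) (inner H (u n) (u m))) N) N) N).
{ apply sum_n_ext => j. rewrite -inner_norm /dft inner_sum_l.
  apply sum_n_ext => n. rewrite inner_sum_r.
  apply sum_n_ext => m. rewrite inner_scal_l inner_scal_r. C_ring. }
rewrite sum_n_switch.
transitivity (sum_n (fun n => Cmult (RtoC (INR (S N))) (RtoC (norm (u n) ^ 2))) N).
2: exact (sum_n_mult_l (K := C_Ring) _ _ _).
apply sum_n_ext_loc => n Hn.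
rewrite sum_n_switch.
transitivity (sum_n (fun m => if Nat.eqb n m
   then Cmult (RtoC (INR (S N))) (inner H (u n) (u m)) else RtoC 0) N).
2: by rewrite sum_n_delta // inner_norm.
apply sum_n_ext_loc => m Hm.
transitivity (Cmult (sum_n (fun j => Cmult (character N j n) (Cconj (character N j m))) N)
   (inner H (u n) (u m))).
{ exact (sum_n_mult_r (K := C_Ring) _ _ _). }
rewrite character_orthogonal //.
destruct (Nat.eqb n m); [easy | C_ring].
Qed.

(** Predecessor in the cyclic group of order [N + 1]. *)
Definition cpred (N n : nat) : nat := match n with O => N | S k => k end.

Lemma sum_n_first (G : AbelianMonoid) (f : nat -> G) (N : nat) :
  sum_n f (S N) = plus (f 0%nat) (sum_n (fun n => f (S n)) N).
Proof.
induction N as [|N IH]; first by rewrite sum_Sn !sum_O.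
rewrite sum_Sn IH (sum_Sn (fun n => f (S n))). by rewrite plus_assoc.
Qed.

Lemma character_S (N j n : nat) :
  character N j (S n) = Cmult (character N j 1) (character N j n).
Proof. rewrite /character -cis_plus (S_INR n) INR_1. f_equal. ring. Qed.

Lemma character_period (N j : nat) :
  Cmult (character N j 1) (character N j N) = character N j 0.
Proof.
rewrite -character_S /character Rmult_0_r cis_0.
replace (2 * PI / INR (S N) * INR j * INR (S N)) with (2 * PI * INR j).
- apply cis_period.
- field. apply not_0_INR. lia.
Qed.

Lemma dft_cpred (N j : nat) (u : nat -> H) :
  dft N (fun n => u (cpred N n)) j = scal (character N j 1) (dft N u j).
Proof.
transitivity (sum_n (fun n => scal (Cmult (character N j 1) (character N j n)) (u n)) N).
2: { rewrite /dft. rewrite -(sum_n_scal_l (V := H)). apply sum_n_ext => n.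
     symmetry; exact (scal_assoc (V := H) _ _ _). }
destruct N as [|N].
- rewrite /dft !sum_O /= character_period //.
- rewrite /dft sum_n_first sum_Sn /= -character_period plus_comm. f_equal.
  apply sum_n_ext => n. by rewrite character_S.
Qed.

End Fourier.

(** * Finite sums *)

Lemma sum_f_R0_mono (f : nat -> R) (K N : nat) :
  (forall n, 0 <= f n) -> (K <= N)%nat -> sum_f_R0 f K <= sum_f_R0 f N.
Proof.
intros Hf; induction 1 as [|N HN IH]; first apply Rle_refl.
simpl. generalize (Hf (S N)); lra.
Qed.

Lemma term_le_sum (f : nat -> R) (N k : nat) :
  (forall n, 0 <= f n) -> (k <= N)%nat -> f k <= sum_f_R0 f N.
Proof.
intros Hf Hk. apply Rle_trans with (2 := sum_f_R0_mono f k N Hf Hk).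
destruct k; simpl; [lra | generalize (cond_pos_sum f k Hf); lra].
Qed.

Lemma sum_f_R0_scal (a : R) (f : nat -> R) (N : nat) :
  sum_f_R0 (fun n => a * f n) N = a * sum_f_R0 f N.
Proof. rewrite scal_sum. apply sum_eq => i _. ring. Qed.

Lemma sum_f_R0_first (f : nat -> R) (N : nat) :
  sum_f_R0 f (S N) = f 0%nat + sum_f_R0 (fun n => f (S n)) N.
Proof. induction N as [|N IH]; [easy|]. rewrite tech5 IH /=. ring. Qed.

Lemma sum_f_R0_rev (f : nat -> R) (N : nat) :
  sum_f_R0 (fun n => f (N - n)%nat) N = sum_f_R0 f N.
Proof.
induction N as [|N IH]; [easy|].
rewrite sum_f_R0_first tech5 Rplus_comm Nat.sub_0_r -IH //.
Qed.

Lemma Cauchy_Schwarz_sum (a b : nat -> R) (N : nat) :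
  (sum_f_R0 (fun n => a n * b n) N) ^ 2
  <= sum_f_R0 (fun n => a n ^ 2) N * sum_f_R0 (fun n => b n ^ 2) N.
Proof.
induction N as [|N IH]; first by simpl; lra.
rewrite !tech5.
set (A := sum_f_R0 (fun n => a n ^ 2) N) in *.
set (B := sum_f_R0 (fun n => b n ^ 2) N) in *.
set (X := sum_f_R0 (fun n => a n * b n) N) in *.
assert (HA : 0 <= A) by (apply cond_pos_sum; intros; apply pow2_ge_0).
assert (HB : 0 <= B) by (apply cond_pos_sum; intros; apply pow2_ge_0).
set (p := a (S N)) in *. set (q := b (S N)) in *.
(* The cross term 2 X p q is at most A q^2 + B p^2. *)
assert (HX : 2 * X * (p * q) <= A * q ^ 2 + B * p ^ 2).
{ assert (Hsq : (2 * X * (p * q)) ^ 2 <= (A * q ^ 2 + B * p ^ 2) ^ 2).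
  { assert (X ^ 2 * (p * q) ^ 2 <= A * B * (p * q) ^ 2)
      by (apply Rmult_le_compat_r; [apply pow2_ge_0 | exact IH]).
    generalize (pow2_ge_0 (A * q ^ 2 - B * p ^ 2)). nra. }
  apply Rnot_lt_le => Hlt. generalize (pow2_ge_0 p) (pow2_ge_0 q) => Hp Hq.
  assert (0 <= A * q ^ 2 + B * p ^ 2) by nra.
  nra. }
nra.
Qed.

Lemma Bernoulli_le (e : R) (n : nat) : 0 <= e <= 1 -> 1 - INR n * e <= (1 - e) ^ n.
Proof.
intros He; induction n as [|n IH]; first by simpl; lra.
rewrite S_INR /=.
assert (0 <= INR n) by apply pos_INR.
apply Rle_trans with ((1 - e) * (1 - INR n * e)); [nra|].
apply Rmult_le_compat_l; lra.
Qed.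

(** * Powers of a bounded operator *)

Section Powers.

Context {H : HilbertSpace}.
Variable J : H -> H.
Hypothesis HJ : is_linear J.

Lemma lin_plus x y : J (plus x y) = plus (J x) (J y).
Proof. exact (linear_plus _ HJ x y). Qed.
Lemma lin_scal (a : C) x : J (scal a x) = scal a (J x).
Proof. exact (linear_scal _ HJ a x). Qed.
Lemma lin_zero : J zero = zero.
Proof.
transitivity (J (scal (RtoC 0) zero)).
{ f_equal. vector_ring. }
rewrite lin_scal. vector_ring.
Qed.
Lemma lin_opp x : J (opp x) = opp (J x).
Proof.
transitivity (J (scal (Copp (RtoC 1)) x)).
{ f_equal. vector_ring. }
rewrite lin_scal. vector_ring.
Qed.
Lemma lin_minus x y : J (minus x y) = minus (J x) (J y).
Proof. by rewrite /minus lin_plus lin_opp. Qed.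

Lemma lin_sum (u : nat -> H) (N : nat) : J (sum_n u N) = sum_n (fun n => J (u n)) N.
Proof.
induction N as [|N IH]; first by rewrite !sum_O.
by rewrite !sum_Sn lin_plus IH.
Qed.

Lemma sum_n_minus_scal (a : C) (f g : nat -> H) (N : nat) :
  sum_n (fun n => minus (f n) (scal a (g n))) N
  = minus (sum_n f N) (scal a (sum_n g N)).
Proof.
induction N as [|N IH]; first by rewrite !sum_O.
rewrite !sum_Sn IH. vector_ring.
Qed.

Lemma vnorm_sum (u : nat -> H) (N : nat) :
  norm (sum_n u N) <= sum_f_R0 (fun n => norm (u n)) N.
Proof.
induction N as [|N IH]; first by rewrite sum_O; apply Rle_refl.
rewrite sum_Sn tech5. apply Rle_trans with (1 := vnorm_triangle _ _). lra.
Qed.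

Lemma iter_scal (a : C) x n : Nat.iter n J (scal a x) = scal a (Nat.iter n J x).
Proof. induction n as [|n IH]; [easy | by rewrite /= IH lin_scal]. Qed.

Lemma iter_zero n : Nat.iter n J zero = zero.
Proof.
induction n as [|n IH]; first easy.
transitivity (J zero); [exact (f_equal J IH) | exact lin_zero].
Qed.

(** When [1 - z J] is invertible, this bounds the norm of [J (1 - z J)^-1] by [B]. *)
Definition resolvent_bound (z : C) (B : R) : Prop :=
  forall y : H, norm (J y) <= B * norm (minus y (scal z (J y))).

(** The Fourier transform on the cyclic group turns the cyclic shift into
    multiplication by a root of unity.  At each frequency the estimate is the
    resolvent bound at one point of the circle of radius [r], and Parseval's
    identity sums the frequencies. *)
Lemma cyclic_estimate (r B : R) (u : nat -> H) (N : nat) :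
  0 <= r -> 0 <= B -> (forall z, Cmod z = r -> resolvent_bound z B) ->
  sum_f_R0 (fun n => norm (J (u n)) ^ 2) N
  <= B ^ 2 * sum_f_R0 (fun n =>
       norm (minus (u n) (scal (RtoC r) (J (u (cpred N n))))) ^ 2) N.
Proof.
intros Hr HB Hres.
apply Rmult_le_reg_l with (INR (S N)); first by apply lt_0_INR; lia.
rewrite -parseval -Rmult_assoc (Rmult_comm _ (B ^ 2)) Rmult_assoc -parseval.
rewrite -sum_f_R0_scal. apply sum_Rle => j _.
rewrite -Rpow_mult_distr. apply pow_incr; split; first apply norm_ge_0.
assert (E1 : dft N (fun n => J (u n)) j = J (dft N u j)).
{ rewrite /dft lin_sum. apply sum_n_ext => n. by rewrite lin_scal. }
assert (E2 : dft N (fun n => minus (u n) (scal (RtoC r) (J (u (cpred N n))))) j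
  = minus (dft N u j) (scal (Cmult (RtoC r) (character N j 1)) (J (dft N u j)))).
{ transitivity (minus (dft N u j) (scal (RtoC r) (dft N (fun n => J (u (cpred N n))) j))).
  - rewrite /dft -sum_n_minus_scal. apply sum_n_ext => n. vector_ring.
  - rewrite (dft_cpred N j (fun n => J (u n))) E1. vector_ring. }
rewrite E1 E2. apply Hres.
rewrite Cmod_mult Cmod_R Cmod_cis Rabs_right; lra.
Qed.

Lemma iter_S_comm n x : Nat.iter n J (J x) = J (Nat.iter n J x).
Proof. induction n as [|n IH]; [easy | by rewrite /= IH]. Qed.

Fixpoint evolution (r : R) (f : nat -> H) (n : nat) : H :=
  match n with
  | O => zero
  | S k => plus (scal (RtoC r) (J (evolution r f k))) (f k)
  end.

(** Equivalently, the spectral radius of [r J] is less than [1]. *)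
Definition power_decay (r : R) : Prop :=
  exists n : nat, (1 <= n)%nat /\
    forall x, r ^ n * norm (Nat.iter n J x) <= / 2 * norm x.

Lemma power_decay_small (r : R) (x : H) (K : nat) (eps : R) :
  0 <= r -> power_decay r -> 0 < eps ->
  exists N : nat, (K <= N)%nat /\ r ^ N * norm (Nat.iter N J x) <= eps.
Proof.
intros Hr [n [Hn Hdec]] Heps.
assert (Hk : forall k, r ^ (k * n) * norm (Nat.iter (k * n) J x) <= (/ 2) ^ k * norm x).
{ induction k as [|k IH]; first by simpl; lra.
  rewrite Nat.mul_succ_l Nat.add_comm pow_add Nat.iter_add.
  apply Rle_trans with (r ^ (k * n) * (/ 2 * norm (Nat.iter (k * n) J x))).
  - rewrite (Rmult_comm (r ^ n)) Rmult_assoc.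
    apply Rmult_le_compat_l; [by apply pow_le | apply Hdec].
  - simpl. lra. }
destruct (pow_lt_1_zero (/ 2) ltac:(rewrite Rabs_right; lra) (eps / (norm x + 1))) as [k0 Hk0].
{ apply Rdiv_lt_0_compat; generalize (norm_ge_0 x); lra. }
exists ((k0 + K) * n)%nat; split; first nia.
apply Rle_trans with (1 := Hk _).
assert (Hp := Hk0 (k0 + K)%nat ltac:(lia)).
rewrite Rabs_right in Hp; last by apply Rle_ge, pow_le; lra.
assert (Hx := norm_ge_0 x).
apply Rmult_lt_compat_r with (r := norm x + 1) in Hp; last lra.
unfold Rdiv in Hp. rewrite Rmult_assoc Rinv_l in Hp; last lra.
assert (0 <= (/ 2) ^ (k0 + K)) by (apply pow_le; lra).
nra.
Qed.

(** The cyclic estimate for long periods.  The only trace of the periodicity is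
    the term [r J u_N] that closes the cycle, and it is small for suitable [N]. *)
Lemma evolution_estimate (r B F : R) (f : nat -> H) :
  0 <= r -> 0 <= B -> (forall z, Cmod z = r -> resolvent_bound z B) ->
  (forall N, sum_f_R0 (fun n => norm (f n) ^ 2) N <= F) ->
  (forall K eps, 0 < eps -> exists N, (K <= N)%nat /\ r * norm (J (evolution r f N)) <= eps) ->
  forall K, sum_f_R0 (fun n => norm (J (evolution r f n)) ^ 2) K <= B ^ 2 * F.
Proof.
intros Hr HB Hres HF Hsmall K.
apply le_epsilon => eps Heps.
set (d := eps / (B ^ 2 + 1)).
assert (HB2 := pow2_ge_0 B).
assert (Hd : 0 < d) by (apply Rdiv_lt_0_compat; lra).
assert (HBd : B ^ 2 * d <= eps).
{ assert (Ed : d * (B ^ 2 + 1) = eps) by (unfold d; field; lra). nra. }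
destruct (Hsmall (S K) (sqrt d)) as [N [HKN HN]]; first by apply sqrt_lt_R0.
apply Rle_trans with (sum_f_R0 (fun n => norm (J (evolution r f n)) ^ 2) N).
{ apply sum_f_R0_mono; [intros; apply pow2_ge_0 | lia]. }
apply Rle_trans with (1 := cyclic_estimate r B (evolution r f) N Hr HB Hres).
apply Rle_trans with (B ^ 2 * (F + d)); last nra.
apply Rmult_le_compat_l; first exact HB2.
destruct N as [|N]; first lia.
rewrite sum_f_R0_first Rplus_comm. apply Rplus_le_compat.
- apply Rle_trans with (2 := HF N). apply Req_le, sum_eq => n _.
  do 2 f_equal. simpl. vector_ring.
- simpl cpred.
  replace (norm (minus (evolution r f 0) (scal (RtoC r) (J (evolution r f (S N))))))
    with (r * norm (J (evolution r f (S N)))).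
  + rewrite -(pow2_sqrt d); last lra.
    apply pow_incr; split; last exact HN.
    apply Rmult_le_pos; [exact Hr | apply norm_ge_0].
  + transitivity (norm (scal (RtoC (- r)) (J (evolution r f (S N))))).
    * rewrite norm_scal_R Rabs_Ropp Rabs_right; lra.
    * f_equal. simpl. vector_ring.
Qed.

(** The orbit of [x] is the evolution forced by [x] at the initial time only. *)
Lemma orbit_square_sum (r B : R) (x : H) (K : nat) :
  0 <= r -> 0 <= B -> (forall z, Cmod z = r -> resolvent_bound z B) ->
  power_decay r ->
  sum_f_R0 (fun n => (r ^ n * norm (Nat.iter (S n) J x)) ^ 2) K
  <= B ^ 2 * norm x ^ 2.
Proof.
intros Hr HB Hres Hdec.
set (f := fun n : nat => match n with O => x | _ => zero : H end).
assert (Hev : forall n, evolution r f (S n) = scal (RtoC (r ^ n)) (Nat.iter n J x)).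
{ induction n as [|n IH].
  - simpl. rewrite lin_zero. vector_ring.
  - simpl in IH |- *. rewrite IH lin_scal. vector_ring. }
assert (Hnorm : forall n, norm (J (evolution r f (S n)))
   = r ^ n * norm (Nat.iter (S n) J x)).
{ intros n. rewrite Hev lin_scal norm_scal_R Rabs_right //.
  by apply Rle_ge, pow_le. }
apply Rle_trans with (sum_f_R0 (fun n => norm (J (evolution r f n)) ^ 2) (S K)).
{ rewrite sum_f_R0_first.
  rewrite -[X in X <= _]Rplus_0_l. apply Rplus_le_compat; first by apply pow2_ge_0.
  apply Req_le, sum_eq => n _. by rewrite Hnorm. }
apply evolution_estimate with (2 := HB); auto.
- intros N. destruct N as [|N]; first by simpl; lra.
  rewrite sum_f_R0_first. simpl f at 1.
  rewrite (sum_eq _ (fun _ => 0)); last by intros; simpl; rewrite norm_zero; ring.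
  rewrite sum_cte. lra.
- intros N eps Heps.
  destruct (power_decay_small r x (S N) eps Hr Hdec Heps) as [[|n] [Hn Hs]]; first lia.
  exists (S n); split; first lia.
  rewrite Hnorm. simpl in Hs |- *. lra.
Qed.

(** Datko's argument.  Splitting [J^(n+2)] as [J^(n-k+1) J^(k+1)], the first factor
    is bounded uniformly and the second is square summable in [k]; summation over
    [k <= n] produces the factor [n + 1]. *)
Lemma orbit_power_bound (r B : R) (x : H) (n : nat) :
  0 <= r -> 0 <= B -> (forall z, Cmod z = r -> resolvent_bound z B) ->
  power_decay r ->
  INR (S n) * (r ^ (n + 2) * norm (Nat.iter (n + 2) J x)) ^ 2
  <= (r ^ 2 * B ^ 2 * norm x) ^ 2.
Proof.
intros Hr HB Hres Hdec.
assert (Hp : forall k, 0 <= r ^ k) by (intros; by apply pow_le).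
assert (Hk : forall k, (k <= n)%nat ->
  (r ^ (n + 2) * norm (Nat.iter (n + 2) J x)) ^ 2
  <= (r ^ 2 * B) ^ 2 * (r ^ k * norm (Nat.iter (S k) J x)) ^ 2).
{ intros k Hkn.
  set (y := Nat.iter (S k) J x).
  assert (Hy : (r ^ (n - k) * norm (Nat.iter (S (n - k)) J y)) ^ 2
     <= B ^ 2 * norm y ^ 2).
  { apply Rle_trans with (2 := orbit_square_sum r B y (n - k) Hr HB Hres Hdec).
    apply (term_le_sum (fun j => (r ^ j * norm (Nat.iter (S j) J y)) ^ 2));
      [intros; apply pow2_ge_0 | lia]. }
  replace (Nat.iter (n + 2) J x) with (Nat.iter (S (n - k)) J y).
  2: rewrite /y -Nat.iter_add; f_equal; lia.
  replace (n + 2)%nat with (2 + k + (n - k))%nat by lia.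
  rewrite !pow_add.
  replace ((r ^ 2 * r ^ k * r ^ (n - k) * norm (Nat.iter (S (n - k)) J y)) ^ 2)
   with ((r ^ 2 * r ^ k) ^ 2 * (r ^ (n - k) * norm (Nat.iter (S (n - k)) J y)) ^ 2) by ring.
  replace ((r ^ 2 * B) ^ 2 * (r ^ k * norm y) ^ 2)
   with ((r ^ 2 * r ^ k) ^ 2 * (B ^ 2 * norm y ^ 2)) by ring.
  apply Rmult_le_compat_l; [apply pow2_ge_0 | exact Hy]. }
rewrite Rmult_comm -sum_cte.
apply Rle_trans with (1 := sum_Rle _ _ _ Hk).
rewrite sum_f_R0_scal.
replace ((r ^ 2 * B ^ 2 * norm x) ^ 2) with ((r ^ 2 * B) ^ 2 * (B ^ 2 * norm x ^ 2)) by ring.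
apply Rmult_le_compat_l; first by apply pow2_ge_0.
by apply orbit_square_sum.
Qed.

(** Decay propagates outwards from small radii, where it is a matter of the norm
    of [J].  By [orbit_power_bound] some power [n0], depending on [r] and [B] alone,
    divides norms by four at every radius [r' <= r] where decay holds.  Enlarging
    such a radius by a factor [1 / (1 - e)] at most doubles the norm of that power,
    so that decay persists, and finitely many enlargements reach [r]. *)
Lemma resolvent_bound_power_decay (r B : R) :
  0 < r -> 0 <= B -> (forall z, Cmod z <= r -> resolvent_bound z B) -> power_decay r.
Proof.
intros Hr HB Hres.
(* A power, the same for all radii at most r, that divides norms by four. *)
assert (Huni : exists n0, (1 <= n0)%nat /\ forall r', 0 <= r' <= r -> power_decay r' ->
   forall x, r' ^ n0 * norm (Nat.iter n0 J x) <= / 4 * norm x).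
{ destruct (INR_archimed 1 (16 * (r ^ 2 * B ^ 2) ^ 2)) as [n Hn]; first lra.
  exists (n + 2)%nat; split; first lia.
  intros r' Hr' Hdec x.
  assert (Hb := orbit_power_bound r' B x n (proj1 Hr') HB
    (fun z Hz => Hres z ltac:(lra)) Hdec).
  assert (Hle : (r' ^ 2 * B ^ 2 * norm x) ^ 2 <= (r ^ 2 * B ^ 2 * norm x) ^ 2).
  { apply pow_incr; split.
    - apply Rmult_le_pos; [|apply norm_ge_0]. apply Rmult_le_pos; apply pow2_ge_0.
    - apply Rmult_le_compat_r; [apply norm_ge_0|].
      apply Rmult_le_compat_r; [apply pow2_ge_0|]. by apply pow_incr. }
  set (a := r' ^ (n + 2) * norm (Nat.iter (n + 2) J x)) in *.
  assert (Ha : 0 <= a) by (apply Rmult_le_pos; [apply pow_le; lra | apply norm_ge_0]).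
  assert (Hx := norm_ge_0 x).
  assert (HSn : 16 * (r ^ 2 * B ^ 2) ^ 2 <= INR (S n)) by (rewrite S_INR; lra).
  assert (HSn1 : 1 <= INR (S n)) by (rewrite S_INR; generalize (pos_INR n); lra).
  apply Rnot_lt_le => Hlt.
  assert (Hsq : (/ 4 * norm x) ^ 2 < a ^ 2) by (simpl; nra).
  assert (INR (S n) * a ^ 2 <= INR (S n) * (norm x ^ 2 / 16)).
  { apply Rle_trans with (1 := Hb). apply Rle_trans with (1 := Hle).
    replace ((r ^ 2 * B ^ 2 * norm x) ^ 2) with ((r ^ 2 * B ^ 2) ^ 2 * norm x ^ 2) by ring.
    assert (0 <= norm x ^ 2) by apply pow2_ge_0. nra. }
  nra. }
destruct Huni as [n0 [Hn0 Huni]].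
assert (HN0 : 1 <= INR n0) by (apply (le_INR 1); lia).
(* By Bernoulli's inequality [(1 - e) ^ n0] is at least one half. *)
set (e := / (2 * INR n0)).
assert (He : 0 < e <= / 2).
{ split; first (apply Rinv_0_lt_compat; lra). apply Rinv_le_contravar; lra. }
assert (Hen : / 2 <= (1 - e) ^ n0).
{ apply Rle_trans with (2 := Bernoulli_le e n0 ltac:(lra)).
  unfold e. apply Req_le. field. lra. }
assert (Hstep : forall r', 0 <= r' <= r -> power_decay ((1 - e) * r') -> power_decay r').
{ intros r' Hr' Hdec. exists n0; split; first exact Hn0.
  intros x. assert (Hx := Huni ((1 - e) * r') ltac:(split; nra) Hdec x).
  rewrite Rpow_mult_distr in Hx.
  assert (Hw : 0 <= r' ^ n0 * norm (Nat.iter n0 J x)).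
  { apply Rmult_le_pos; [apply pow_le; lra | apply norm_ge_0]. }
  nra. }
assert (Hback : forall k, power_decay ((1 - e) ^ k * r) -> power_decay r).
{ induction k as [|k IH] => Hk; first by rewrite /= Rmult_1_l in Hk.
  apply IH, Hstep; last by rewrite -Rmult_assoc.
  assert (0 <= (1 - e) ^ k <= 1).
  { split; [apply pow_le; lra|]. apply Rle_trans with (1 ^ k); [apply pow_incr; lra | rewrite pow1; lra]. }
  split; nra. }
destruct (linear_norm _ HJ) as [M [HM HSM]].
destruct (pow_lt_1_zero (1 - e) ltac:(rewrite Rabs_right; lra) (/ (2 * M * r))) as [k Hk].
{ apply Rinv_0_lt_compat. apply Rmult_lt_0_compat; lra. }
apply (Hback k). exists 1%nat; split; first lia.
intros x. simpl Nat.iter. rewrite pow_1.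
assert (Hk' := Hk k (le_n k)).
rewrite Rabs_right in Hk'; last by apply Rle_ge, pow_le; lra.
assert (Hkr : (1 - e) ^ k * r * M <= / 2).
{ apply Rmult_lt_compat_r with (r := r * M) in Hk'; last nra.
  replace (/ (2 * M * r) * (r * M)) with (/ 2) in Hk' by (field; repeat split; lra). lra. }
assert (Hx := norm_ge_0 x). assert (HSx := HSM x).
assert (0 <= (1 - e) ^ k * r) by (apply Rmult_le_pos; [apply pow_le; lra | lra]).
apply Rle_trans with ((1 - e) ^ k * r * (M * norm x)); [by apply Rmult_le_compat_l | nra].
Qed.

(** The difference [(r^n - rho^n) J^n x] solves the evolution equation at radius
    [r] with forcing [(r - rho) rho^n J^(n+1) x].  This is the resolvent identity
    between the circles of radii [rho] and [r], written in the time domain. *)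
Lemma orbit_transfer (rho r B E : R) (x : H) :
  0 <= rho <= r -> 0 <= B -> (forall z, Cmod z = r -> resolvent_bound z B) ->
  power_decay r ->
  (forall N, sum_f_R0 (fun n => (rho ^ n * norm (Nat.iter (S n) J x)) ^ 2) N <= E) ->
  forall K, sum_f_R0 (fun n => (r ^ n * norm (Nat.iter (S n) J x)) ^ 2) K
    <= 2 * (1 + B ^ 2 * (r - rho) ^ 2) * E.
Proof.
intros Hrho HB Hres Hdec HE K.
assert (Hr : 0 <= r) by lra.
assert (Hpw : forall n, 0 <= rho ^ n <= r ^ n).
{ intros n; split; [apply pow_le; lra | by apply pow_incr]. }
set (a := fun n => norm (Nat.iter (S n) J x)).
assert (Ha : forall n, 0 <= a n) by (intros; apply norm_ge_0).
set (f := fun n => scal (RtoC ((r - rho) * rho ^ n)) (Nat.iter (S n) J x)).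
assert (Hev : forall n, evolution r f n = scal (RtoC (r ^ n - rho ^ n)) (Nat.iter n J x)).
{ induction n as [|n IH].
  - simpl. vector_ring.
  - simpl evolution. rewrite IH lin_scal /f. simpl. vector_ring. }
assert (Hnorm : forall n, norm (J (evolution r f n)) = (r ^ n - rho ^ n) * a n).
{ intros n. rewrite Hev lin_scal norm_scal_R Rabs_right //. generalize (Hpw n); lra. }
assert (Hdiff : sum_f_R0 (fun n => norm (J (evolution r f n)) ^ 2) K
   <= B ^ 2 * ((r - rho) ^ 2 * E)).
{ apply evolution_estimate; auto.
  - intros N. apply Rle_trans with ((r - rho) ^ 2 *
      sum_f_R0 (fun n => (rho ^ n * a n) ^ 2) N).
    + rewrite -sum_f_R0_scal. apply Req_le, sum_eq => n _.
      rewrite /f norm_scal_R Rabs_right /a; first ring.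
      apply Rle_ge, Rmult_le_pos; [lra | apply Hpw].
    + apply Rmult_le_compat_l; [apply pow2_ge_0 | apply HE].
  - intros N eps Heps.
    destruct (power_decay_small r x (S N) eps Hr Hdec Heps) as [[|n] [Hn Hs]]; first lia.
    exists n; split; first lia.
    rewrite Hnorm. apply Rle_trans with (2 := Hs). simpl pow.
    rewrite Rmult_assoc. apply Rmult_le_compat_l; first exact Hr.
    apply Rmult_le_compat_r; [apply Ha | generalize (Hpw n); lra]. }
apply Rle_trans with (2 * sum_f_R0 (fun n => norm (J (evolution r f n)) ^ 2) K
   + 2 * sum_f_R0 (fun n => (rho ^ n * a n) ^ 2) K).
{ rewrite -!sum_f_R0_scal -sum_plus. apply sum_Rle => n _.
  rewrite Hnorm -/(a n).
  generalize (pow2_ge_0 ((r ^ n - rho ^ n) * a n - rho ^ n * a n)). nra. }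
assert (HEK := HE K). fold a in HEK. unfold a in HEK |- *. lra.
Qed.

Lemma evolution_after (r : R) (f : nat -> H) (m n : nat) :
  (forall j, (m <= j)%nat -> f j = zero) ->
  evolution r f (n + m) = scal (RtoC (r ^ n)) (Nat.iter n J (evolution r f m)).
Proof.
intros Hf; induction n as [|n IH]; simpl.
- vector_ring.
- rewrite IH Hf; last lia. rewrite lin_scal. vector_ring.
Qed.

Lemma evolution_change_rate (rho r : R) (f : nat -> H) (n : nat) :
  evolution r f n = evolution rho
    (fun j => plus (f j) (scal (RtoC (r - rho)) (J (evolution r f j)))) n.
Proof.
induction n as [|n IH]; [easy | simpl]. rewrite -IH. vector_ring.
Qed.

Lemma evolution_sum (r : R) (f : nat -> H) (m : nat) :
  evolution r f (S m)
  = sum_n (fun j => scal (RtoC (r ^ (m - j))) (Nat.iter (m - j) J (f j))) m.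
Proof.
induction m as [|m IH].
- rewrite sum_O. simpl. rewrite lin_zero. vector_ring.
- rewrite sum_Sn Nat.sub_diag.
  change (evolution r f (S (S m)))
    with (plus (scal (RtoC r) (J (evolution r f (S m)))) (f (S m))).
  rewrite IH lin_sum -(sum_n_scal_l (V := H)).
  f_equal; last (simpl; vector_ring).
  apply sum_n_ext_loc => j Hj.
  replace (S m - j)%nat with (S (m - j)) by lia.
  rewrite lin_scal. simpl. vector_ring.
Qed.

Lemma norm_evolution_le (r : R) (f : nat -> H) (c : nat -> R) (m : nat) :
  0 <= r -> (forall n x, r ^ n * norm (Nat.iter n J x) <= c n * norm x) ->
  norm (evolution r f (S m)) <= sum_f_R0 (fun j => c (m - j)%nat * norm (f j)) m.
Proof.
intros Hr Hc. rewrite evolution_sum.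
apply Rle_trans with (1 := vnorm_sum _ _). apply sum_Rle => j Hj.
rewrite norm_scal_R Rabs_right; [apply Hc | by apply Rle_ge, pow_le].
Qed.

(** Dual of [orbit_transfer]: it bounds the final value of an evolution by the
    forcing, and takes the place of a square function estimate for the adjoint
    of [J].  An evolution [u] at radius [r] is also an evolution at radius [rho], with
    the forcing increased by [(r - rho) J u], whose size [evolution_estimate]
    controls. *)
Lemma evolution_transfer (rho r B E : R) (c : nat -> R) (f : nat -> H) (m : nat) :
  0 <= rho <= r -> 0 <= B -> (forall z, Cmod z = r -> resolvent_bound z B) ->
  power_decay r ->
  (forall n x, rho ^ n * norm (Nat.iter n J x) <= c n * norm x) ->
  (forall N, sum_f_R0 (fun n => c n ^ 2) N <= E) ->
  (forall j, (m < j)%nat -> f j = zero) ->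
  norm (evolution r f (S m)) ^ 2
  <= 2 * (1 + B ^ 2 * (r - rho) ^ 2) * E * sum_f_R0 (fun j => norm (f j) ^ 2) m.
Proof.
intros Hrho HB Hres Hdec Hc HE Hf.
assert (Hr : 0 <= r) by lra.
set (F := sum_f_R0 (fun j => norm (f j) ^ 2) m).
assert (HF : forall N, sum_f_R0 (fun j => norm (f j) ^ 2) N <= F).
{ intros N. destruct (Nat.le_gt_cases N m) as [HNm | HNm].
  - by apply sum_f_R0_mono; [intros; apply pow2_ge_0|].
  - apply Req_le. unfold F. replace N with (m + (N - m))%nat by lia.
    induction (N - m)%nat as [|k IH]; first by rewrite Nat.add_0_r.
    rewrite Nat.add_succ_r tech5 IH Hf; last lia. rewrite norm_zero. ring. }
assert (HSev : sum_f_R0 (fun n => norm (J (evolution r f n)) ^ 2) m <= B ^ 2 * F).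
{ apply evolution_estimate; auto.
  intros K eps Heps.
  set (y := evolution r f (S m)).
  destruct (power_decay_small r y (S K) eps Hr Hdec Heps) as [[|n] [Hn Hs]]; first lia.
  exists (n + S m)%nat; split; first lia.
  rewrite evolution_after; last by (intros; apply Hf; lia).
  rewrite lin_scal norm_scal_R Rabs_right; last by apply Rle_ge, pow_le.
  rewrite -Rmult_assoc. exact Hs. }
rewrite (evolution_change_rate rho r f).
set (k := fun j => plus (f j) (scal (RtoC (r - rho)) (J (evolution r f j)))).
assert (Hk : sum_f_R0 (fun j => norm (k j) ^ 2) m <= 2 * (1 + B ^ 2 * (r - rho) ^ 2) * F).
{ apply Rle_trans with (2 * F + 2 * (r - rho) ^ 2 *
    sum_f_R0 (fun n => norm (J (evolution r f n)) ^ 2) m).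
  - unfold F. rewrite -!sum_f_R0_scal -sum_plus. apply sum_Rle => j _.
    assert (Hj : norm (k j) <= norm (f j) + (r - rho) * norm (J (evolution r f j))).
    { apply Rle_trans with (1 := vnorm_triangle _ _).
      rewrite norm_scal_R Rabs_right; lra. }
    assert (Hk0 := norm_ge_0 (k j)).
    assert (Hsq : norm (k j) ^ 2 <= (norm (f j) + (r - rho) * norm (J (evolution r f j))) ^ 2)
      by (by apply pow_incr).
    generalize (pow2_ge_0 (norm (f j) - (r - rho) * norm (J (evolution r f j)))). nra.
  - assert (0 <= (r - rho) ^ 2) by apply pow2_ge_0. nra. }
assert (Hn := norm_evolution_le rho k c m (proj1 Hrho) Hc).
apply Rle_trans with ((sum_f_R0 (fun j => c (m - j)%nat * norm (k j)) m) ^ 2).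
{ apply pow_incr; split; [apply norm_ge_0 | exact Hn]. }
apply Rle_trans with (1 := Cauchy_Schwarz_sum _ _ _).
rewrite (sum_f_R0_rev (fun j => c j ^ 2)).
assert (Hc0 : 0 <= sum_f_R0 (fun j => c j ^ 2) m) by (apply cond_pos_sum; intros; apply pow2_ge_0).
assert (Hk0 : 0 <= sum_f_R0 (fun j => norm (k j) ^ 2) m) by (apply cond_pos_sum; intros; apply pow2_ge_0).
assert (HEm := HE m).
nra.
Qed.

End Powers.

(** * The uniform boundedness principle *)

Section Boundedness.

Context {H : HilbertSpace}.

Lemma op_norm_bound (L : H -> H) (x : H) :
  is_linear L -> norm (L x) <= op_norm L * norm x.
Proof.
intros HL. destruct (op_norm_lub L HL) as [Hub _].
destruct (Req_dec (norm x) 0) as [Hx | Hx].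
- destruct (linear_norm _ HL) as [M [_ HM]].
  generalize (HM x). rewrite Hx. lra.
- assert (Hx0 : 0 < norm x) by (generalize (norm_ge_0 x); lra).
  assert (Hi : 0 < / norm x) by (by apply Rinv_0_lt_compat).
  assert (Hs : norm (L (scal (RtoC (/ norm x)) x)) <= op_norm L).
  { apply Hub. exists (scal (RtoC (/ norm x)) x). split; last easy.
    rewrite norm_scal_R Rabs_right; last lra. rewrite Rinv_l //. lra. }
  assert (E : L (scal (RtoC (/ norm x)) x) = scal (RtoC (/ norm x)) (L x))
    by exact (linear_scal _ HL _ _).
  rewrite E norm_scal_R Rabs_right in Hs; last lra.
  apply Rmult_le_compat_r with (r := norm x) in Hs; last lra.
  replace (/ norm x * norm (L x) * norm x) with (norm (L x)) in Hs by (field; lra).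
  exact Hs.
Qed.

Lemma op_norm_le (L : H -> H) (c : R) :
  is_linear L -> 0 <= c -> (forall x : H, norm (L x) <= c * norm x) -> op_norm L <= c.
Proof.
intros HL Hc Hb. destruct (op_norm_lub L HL) as [_ Hl]. apply Hl.
intros r [x [Hx ->]]. apply Rle_trans with (1 := Hb x).
rewrite -[X in _ <= X]Rmult_1_r. by apply Rmult_le_compat_l.
Qed.

(** Gliding hump: moving [x] by at most [d] in the direction of a nearly norming
    vector of [L], with the better of the two signs, makes [L x] large. *)
Lemma large_image_nearby (L : H -> H) (x : H) (d : R) :
  is_linear L -> 0 <= d -> 0 < op_norm L ->
  exists y : H, norm (minus y x) <= d /\ 3 / 4 * op_norm L * d <= norm (L y).
Proof.
intros HL Hd HN.
assert (Hv : exists v : H, norm v <= 1 /\ 3 / 4 * op_norm L <= norm (L v)).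
{ apply NNPP => Hno. destruct (op_norm_lub L HL) as [_ Hl].
  assert (op_norm L <= 3 / 4 * op_norm L); last lra.
  apply Hl. intros r [v [Hv ->]]. apply Rnot_lt_le => Hlt.
  apply Hno. exists v; split; lra. }
destruct Hv as [v [Hv HLv]].
set (w := scal (RtoC d) v).
assert (Hw : norm w <= d).
{ unfold w. rewrite norm_scal_R Rabs_right; last lra. nra. }
assert (HLw : 3 / 4 * op_norm L * d <= norm (L w)).
{ assert (E : L w = scal (RtoC d) (L v)) by exact (linear_scal _ HL _ _).
  rewrite E norm_scal_R Rabs_right; last lra. nra. }
assert (Htwo : norm (L w) <= / 2 * (norm (L (plus x w)) + norm (L (minus x w)))).
{ assert (E : L w = scal (RtoC (/ 2)) (minus (L (plus x w)) (L (minus x w)))).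
  { assert (E1 : L (plus x w) = plus (L x) (L w)) by exact (linear_plus _ HL _ _).
    assert (E2 : L (minus x w) = minus (L x) (L w)).
    { assert (E3 : L (opp w) = opp (L w)).
      { transitivity (L (scal (Copp (RtoC 1)) w)); first (f_equal; vector_ring).
        transitivity (scal (Copp (RtoC 1)) (L w)); last vector_ring.
        exact (linear_scal _ HL _ _). }
      unfold minus. rewrite -E3. exact (linear_plus _ HL _ _). }
    rewrite E1 E2. vector_expand. rewrite RtoC_inv; last lra. field. }
  rewrite {1}E norm_scal_R Rabs_right; last lra.
  apply Rmult_le_compat_l; [lra | apply vnorm_minus]. }
clearbody w.
destruct (Rle_lt_dec (norm (L w)) (norm (L (plus x w)))) as [Hp | Hp].
- exists (plus x w). split; last lra.
  replace (minus (plus x w) x) with w by vector_ring. exact Hw.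
- exists (minus x w). split; last lra.
  replace (minus (minus x w) x) with (opp w) by vector_ring. by rewrite vnorm_opp.
Qed.

Lemma geometric_cauchy (x : nat -> H) :
  (forall k, norm (minus (x (S k)) (x k)) <= (/ 3) ^ S k) ->
  exists l : H, forall k, norm (minus l (x k)) <= / 2 * (/ 3) ^ k.
Proof.
intros Hstep.
assert (Hmk : forall k n, norm (minus (x (k + n)%nat) (x k)) <= / 2 * (/ 3) ^ k - / 2 * (/ 3) ^ (k + n)).
{ intros k; induction n as [|n IH].
  - rewrite Nat.add_0_r.
    replace (minus (x k) (x k)) with (zero : H) by vector_ring.
    rewrite norm_zero. lra.
  - replace (minus (x (k + S n)%nat) (x k))
      with (plus (minus (x (S (k + n))) (x (k + n)%nat)) (minus (x (k + n)%nat) (x k))).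
    2: rewrite Nat.add_succ_r; vector_ring.
    apply Rle_trans with (1 := vnorm_triangle _ _).
    generalize (Hstep (k + n)%nat). rewrite Nat.add_succ_r. simpl. lra. }
assert (Hp : forall k, 0 < (/ 3) ^ k) by (intros; apply pow_lt; lra).
assert (Hle : forall k m, (k <= m)%nat -> norm (minus (x m) (x k)) <= / 2 * (/ 3) ^ k).
{ intros k m Hkm. assert (Hi := Hmk k (m - k)%nat).
  replace (k + (m - k))%nat with m in Hi by lia. generalize (Hp m); lra. }
destruct (proj1 (filterlim_locally_cauchy (F := eventually) x)) as [l Hl].
{ intros eps.
  destruct (pow_lt_1_zero (/ 3) ltac:(rewrite Rabs_right; lra) eps) as [k Hk]; first apply cond_pos.
  exists (fun n => (k <= n)%nat). split; first by exists k.
  assert (Hkk := Hk k (le_n k)). rewrite Rabs_right in Hkk; last by apply Rle_ge, Rlt_le.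
  intros u v Hu Hv. apply (norm_compat1 (V := H)).
  change (norm (minus (x v) (x u)) < eps).
  replace (minus (x v) (x u)) with (minus (minus (x v) (x k)) (minus (x u) (x k))) by vector_ring.
  apply Rle_lt_trans with (1 := vnorm_minus _ _).
  apply Rle_lt_trans with (/ 2 * (/ 3) ^ k + / 2 * (/ 3) ^ k); last lra.
  by apply Rplus_le_compat; apply Hle. }
exists l. intros k. apply le_epsilon => eps Heps.
apply (filterlim_locally_ball_norm (U := H)) with (eps := mkposreal eps Heps) in Hl.
destruct Hl as [n0 Hn0].
assert (Hn := Hn0 (n0 + k)%nat ltac:(lia)). unfold ball_norm in Hn. simpl in Hn.
replace (minus l (x k)) with (minus (minus (x (n0 + k)%nat) (x k)) (minus (x (n0 + k)%nat) l)) by vector_ring.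
apply Rle_trans with (1 := vnorm_minus _ _).
apply Rplus_le_compat; [apply Hle; lia | by apply Rlt_le].
Qed.

(** If the norms of the [L n] were unbounded, steps of length [3^-(k+1)] through
    operators of norm at least [4^k] would lead to a point [l] that stays within
    [3^-(k+1) / 2] of the k-th hump, hence to values at [l] of size [(4/3)^k / 12]. *)
Lemma uniform_boundedness (L : nat -> H -> H) :
  (forall n, is_linear (L n)) ->
  (forall x, exists c, forall n, norm (L n x) <= c) ->
  exists c, forall n x, norm (L n x) <= c * norm x.
Proof.
intros HL Hpt. apply NNPP => Hno.
assert (Hbig : forall c, exists n, c < op_norm (L n)).
{ intros c. apply NNPP => Hn. apply Hno. exists c. intros n x.
  apply Rle_trans with (1 := op_norm_bound (L n) x (HL n)).
  apply Rmult_le_compat_r; first apply norm_ge_0.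
  apply Rnot_lt_le => Hlt. apply Hn. by exists n. }
assert (Hstep : forall (p : nat * H), exists q : nat * H,
  4 ^ fst p < op_norm (L (fst q)) /\
  norm (minus (snd q) (snd p)) <= (/ 3) ^ S (fst p) /\
  3 / 4 * op_norm (L (fst q)) * (/ 3) ^ S (fst p) <= norm (L (fst q) (snd q))).
{ intros [k x]. destruct (Hbig (4 ^ k)) as [n Hn].
  assert (0 < 4 ^ k) by (apply pow_lt; lra).
  destruct (large_image_nearby (L n) x ((/ 3) ^ S k)) as [y Hy]; auto.
  - apply pow_le; lra.
  - lra.
  - exists (n, y). simpl fst; simpl snd. split; [lra | exact Hy]. }
set (next := fun p => proj1_sig (constructive_indefinite_description _ (Hstep p))).
set (x := fix x (k : nat) : H := match k with O => zero | S j => snd (next (j, x j)) end).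
set (n := fun k => fst (next (k, x k))).
assert (Hx : forall k, 4 ^ k < op_norm (L (n k)) /\
  norm (minus (x (S k)) (x k)) <= (/ 3) ^ S k /\
  3 / 4 * op_norm (L (n k)) * (/ 3) ^ S k <= norm (L (n k) (x (S k)))).
{ intros k. unfold n. simpl x.
  destruct (proj2_sig (constructive_indefinite_description _ (Hstep (k, x k)))) as [H1 H2].
  split; [exact H1 | exact H2]. }
destruct (geometric_cauchy x) as [l Hl]; first by intros; apply Hx.
destruct (Hpt l) as [c Hc].
assert (Hlow : forall k, / 12 * (4 / 3) ^ k <= c).
{ intros k. destruct (Hx k) as [H1 [_ H3]].
  apply Rle_trans with (2 := Hc (n k)).
  assert (E : L (n k) (x (S k)) = minus (L (n k) l) (L (n k) (minus l (x (S k))))).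
  { assert (E1 : L (n k) (plus (minus l (x (S k))) (x (S k))) =
      plus (L (n k) (minus l (x (S k)))) (L (n k) (x (S k)))) by exact (linear_plus _ (HL _) _ _).
    replace (plus (minus l (x (S k))) (x (S k))) with l in E1 by vector_ring.
    rewrite {1}E1. vector_ring. }
  assert (Hd := op_norm_bound (L (n k)) (minus l (x (S k))) (HL _)).
  assert (Hle := vnorm_minus (L (n k) l) (L (n k) (minus l (x (S k))))).
  rewrite -E in Hle.
  assert (Hlk := Hl (S k)).
  assert (0 < 4 ^ k) by (apply pow_lt; lra).
  assert (Hp : 0 < (/ 3) ^ k) by (apply pow_lt; lra).
  assert (Hd' : norm (L (n k) (minus l (x (S k)))) <= op_norm (L (n k)) * (/ 2 * (/ 3) ^ S k)).
  { apply Rle_trans with (1 := Hd). apply Rmult_le_compat_l; lra. }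
  set (N := op_norm (L (n k))) in *.
  assert (HN : / 12 * (4 / 3) ^ k <= N * (/ 12 * (/ 3) ^ k)).
  { unfold Rdiv. rewrite Rpow_mult_distr. nra. }
  simpl pow in H3, Hd'. lra. }
destruct (Pow_x_infinity (4 / 3) ltac:(rewrite Rabs_right; lra) (12 * c + 1)) as [k Hk].
assert (Hkk := Hk k (le_n k)). rewrite Rabs_right in Hkk.
- generalize (Hlow k). lra.
- apply Rle_ge, pow_le. lra.
Qed.

End Boundedness.

(** * Exponential bound and equivalent norm *)

Lemma exp_le_1_2 (u : R) : 0 <= u <= / 2 -> exp u <= 1 + 2 * u.
Proof.
intros Hu. assert (He := exp_ineq1_le (- u)).
assert (Hm : exp u * exp (- u) = 1) by (rewrite -exp_plus Rplus_opp_r; exact exp_0).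
assert (Hp := exp_pos u). nra.
Qed.

Lemma exp_ge_inv (u : R) : 0 <= u <= / 2 -> 1 <= (1 - u) * exp (2 * u).
Proof.
intros Hu. assert (He := exp_ineq1_le (2 * u)). nra.
Qed.

Lemma exp_nat (n : nat) (u : R) : exp (INR n * u) = exp u ^ n.
Proof.
induction n as [|n IH]; first by rewrite Rmult_0_l exp_0.
by rewrite S_INR Rmult_plus_distr_r Rmult_1_l Rplus_comm exp_plus IH.
Qed.

Section Semigroup.

Context {H : HilbertSpace}.
Variable T : R -> H -> H.
Hypothesis HT : C0_semigroup T.

Lemma at_right_0_elim (P : R -> Prop) :
  at_right 0 P -> exists d, 0 < d /\ forall t, 0 < t < d -> P t.
Proof.
intros [d Hd]. exists d; split; first apply cond_pos.
intros t Ht. apply Hd; last apply Ht.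
unfold ball; simpl; unfold AbsRing_ball, abs, minus, plus, opp; simpl.
rewrite Rabs_right; lra.
Qed.

Lemma semigroup_near_0 (x : H) (eps : R) : 0 < eps ->
  exists d, 0 < d /\ forall t, 0 <= t < d -> norm (minus (T t x) x) < eps.
Proof.
intros Heps.
assert (Hc := semigroup_continuous T HT x).
apply (filterlim_locally_ball_norm (U := H)) with (eps := mkposreal eps Heps) in Hc.
destruct (at_right_0_elim _ Hc) as [d [Hd Hball]].
exists d; split; first exact Hd.
intros t Ht. destruct (Req_dec t 0) as [-> | Ht0].
- rewrite (semigroup_0 T HT).
  replace (minus x x) with (zero : H) by vector_ring. by rewrite norm_zero.
- apply (Hball t). lra.
Qed.

Lemma generator_near_0 (x z : H) (eps : R) : generator T x z -> 0 < eps ->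
  exists d, 0 < d /\ forall t, 0 < t < d ->
    norm (minus (scal (RtoC (/ t)) (minus (T t x) x)) z) < eps.
Proof.
intros Hg Heps.
apply (filterlim_locally_ball_norm (U := H)) with (eps := mkposreal eps Heps) in Hg.
exact (at_right_0_elim _ Hg).
Qed.

(** Otherwise operators [T (t n)] with [t n] tending to [0] have unbounded norms,
    although they converge pointwise. *)
Lemma semigroup_bounded_near_0 :
  exists eta M, 0 < eta /\ 1 <= M /\
    forall t x, 0 <= t <= eta -> norm (T t x) <= M * norm x.
Proof.
apply NNPP => Hno.
assert (Hbad : forall n : nat, exists t, 0 <= t <= / INR (S n) /\
   exists x, INR (S n) * norm x < norm (T t x)).
{ intros n. assert (Hn : 1 <= INR (S n)) by (rewrite S_INR; generalize (pos_INR n); lra).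
  apply NNPP => Hn'. apply Hno.
  exists (/ INR (S n)), (INR (S n)); repeat split.
  - apply Rinv_0_lt_compat; lra.
  - exact Hn.
  - intros t x Ht. apply Rnot_lt_le => Hlt. apply Hn'. exists t; split; first exact Ht. by exists x. }
set (t := fun n => proj1_sig (constructive_indefinite_description _ (Hbad n))).
assert (Ht : forall n, 0 <= t n <= / INR (S n) /\
   exists x, INR (S n) * norm x < norm (T (t n) x)).
{ intros n. exact (proj2_sig (constructive_indefinite_description _ (Hbad n))). }
destruct (uniform_boundedness (fun n => T (t n))) as [c Hc].
- intros n. apply (semigroup_linear T HT), Ht.
- intros x.
  destruct (semigroup_near_0 x 1 ltac:(lra)) as [d [Hd Hnear]].
  destruct (archimed_cor1 d Hd) as [n0 [Hn0 Hn0']].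
  exists (sum_f_R0 (fun n => norm (T (t n) x)) n0 + (norm x + 1)).
  intros n.
  assert (Hs : 0 <= sum_f_R0 (fun n => norm (T (t n) x)) n0)
    by (apply cond_pos_sum; intros; apply norm_ge_0).
  destruct (Nat.le_gt_cases n n0) as [Hn | Hn].
  + assert (Hl := term_le_sum (fun n => norm (T (t n) x)) n0 n (fun _ => norm_ge_0 _) Hn).
    assert (Hx := norm_ge_0 x). cbv beta in Hl |- *. lra.
  + assert (Htn : 0 <= t n < d).
    { split; first apply Ht. apply Rle_lt_trans with (1 := proj2 (proj1 (Ht n))).
      apply Rle_lt_trans with (2 := Hn0). apply Rinv_le_contravar.
      - apply lt_0_INR; lia.
      - apply le_INR; lia. }
    assert (Hle := vnorm_split _ (T (t n) x) x).
    assert (Hnn := Hnear _ Htn). cbv beta. lra.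
- destruct (INR_archimed 1 c) as [n Hn]; first lra.
  destruct (Ht n) as [_ [x Hx]]. assert (Hcx := Hc n x). assert (Hx0 := norm_ge_0 x).
  rewrite S_INR in Hx. cbv beta in Hcx. nra.
Qed.

Lemma semigroup_exponential_bound :
  exists M w, 1 <= M /\ 0 <= w /\
    forall t x, 0 <= t -> norm (T t x) <= M * exp (w * t) * norm x.
Proof.
destruct semigroup_bounded_near_0 as [eta [M [Heta [HM Hb]]]].
exists M, (ln M / eta).
assert (Hln : 0 <= ln M) by (rewrite -ln_1; apply ln_le; lra).
assert (Hw : 0 <= ln M / eta) by (by apply Rdiv_le_0_compat).
repeat split; auto.
assert (Hk : forall k t x, 0 <= t <= INR k * eta ->
   norm (T t x) <= M * exp (ln M / eta * t) * norm x).
{ induction k as [|k IH] => t x Ht.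
  - simpl in Ht. assert (t = 0) as -> by lra.
    rewrite (semigroup_0 T HT) Rmult_0_r exp_0. generalize (norm_ge_0 x). nra.
  - destruct (Rle_lt_dec t eta) as [Hte | Hte].
    + apply Rle_trans with (1 := Hb t x ltac:(lra)).
      apply Rmult_le_compat_r; first apply norm_ge_0.
      assert (1 <= exp (ln M / eta * t)); last nra.
      rewrite -exp_0. assert (Hu : 0 <= ln M / eta * t) by (apply Rmult_le_pos; lra).
      destruct Hu as [Hu | <-]; [by apply Rlt_le, exp_increasing | apply Rle_refl].
    + rewrite S_INR in Ht.
      replace t with (eta + (t - eta)) at 1 by ring.
      rewrite (semigroup_plus T HT); try lra.
      apply Rle_trans with (1 := Hb eta _ ltac:(lra)).
      replace (exp (ln M / eta * t)) with (M * exp (ln M / eta * (t - eta))).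
      * rewrite Rmult_assoc. apply Rmult_le_compat_l; first lra.
        apply IH. lra.
      * replace (ln M / eta * t) with (ln M + ln M / eta * (t - eta)) by (field; lra).
        rewrite exp_plus exp_ln; lra. }
intros t x Ht. destruct (INR_archimed eta t Heta) as [k Hk'].
apply (Hk k); lra.
Qed.

Variables M w : R.
Hypothesis HM : 1 <= M.
Hypothesis Hw : 0 <= w.
Hypothesis Hgrowth : forall t x, 0 <= t -> norm (T t x) <= M * exp (w * t) * norm x.

Definition renorm_set (x : H) (r : R) : Prop :=
  exists t, 0 <= t /\ r = exp (- (w * t)) * norm (T t x).

(** The equivalent norm [sup_t exp (- w t) |T t x|], in which [T t] has norm at
    most [exp (w t)]. *)
Definition renorm (x : H) : R := real (Lub_Rbar (renorm_set x)).

Lemma renorm_set_le (x : H) (r : R) : renorm_set x r -> r <= M * norm x.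
Proof.
intros [t [Ht ->]].
apply Rle_trans with (exp (- (w * t)) * (M * exp (w * t) * norm x)).
- apply Rmult_le_compat_l; [apply Rlt_le, exp_pos | by apply Hgrowth].
- assert (E : exp (- (w * t)) * exp (w * t) = 1) by (rewrite -exp_plus Rplus_opp_l; exact exp_0).
  apply Req_le. rewrite -[M * norm x]Rmult_1_l -E. ring.
Qed.

Lemma renorm_lub (x : H) : is_lub (renorm_set x) (renorm x).
Proof.
unfold renorm. destruct (Lub_Rbar_correct (renorm_set x)) as [H1 H2].
assert (H3 := H2 (Finite (M * norm x)) (renorm_set_le x)).
assert (H0 : Rbar_le (Finite (exp (- (w * 0)) * norm (T 0 x))) (Lub_Rbar (renorm_set x))).
{ apply H1. exists 0; split; [lra | easy]. }
destruct (Lub_Rbar (renorm_set x)) as [l | |]; simpl in *; try easy.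
split.
- intros r Hr; exact (H1 r Hr).
- intros b Hb; apply (H2 (Finite b)); intros r Hr; exact (Hb r Hr).
Qed.

Lemma norm_le_renorm (x : H) : norm x <= renorm x.
Proof.
apply (proj1 (renorm_lub x)). exists 0; split; first lra.
by rewrite Rmult_0_r Ropp_0 exp_0 (semigroup_0 T HT) Rmult_1_l.
Qed.

Lemma renorm_le_norm (x : H) : renorm x <= M * norm x.
Proof. apply (proj2 (renorm_lub x)). exact (renorm_set_le x). Qed.

Lemma renorm_plus (x y : H) : renorm (plus x y) <= renorm x + renorm y.
Proof.
apply (proj2 (renorm_lub (plus x y))). intros r [t [Ht ->]].
rewrite (lin_plus (T t) (semigroup_linear T HT t Ht)).
apply Rle_trans with (exp (- (w * t)) * norm (T t x) + exp (- (w * t)) * norm (T t y)).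
- rewrite -Rmult_plus_distr_l. apply Rmult_le_compat_l; [apply Rlt_le, exp_pos | apply vnorm_triangle].
- apply Rplus_le_compat; [apply (proj1 (renorm_lub x)) | apply (proj1 (renorm_lub y))]; by exists t.
Qed.

Lemma renorm_scal (a : R) (x : H) : renorm (scal (RtoC a) x) <= Rabs a * renorm x.
Proof.
apply (proj2 (renorm_lub _)). intros r [t [Ht ->]].
rewrite (lin_scal (T t) (semigroup_linear T HT t Ht)) norm_scal_R -Rmult_assoc
  (Rmult_comm _ (Rabs a)) Rmult_assoc.
apply Rmult_le_compat_l; first apply Rabs_pos.
apply (proj1 (renorm_lub x)). by exists t.
Qed.

Lemma renorm_semigroup (t : R) (x : H) : 0 <= t -> renorm (T t x) <= exp (w * t) * renorm x.
Proof.
intros Ht. apply (proj2 (renorm_lub _)). intros r [s [Hs ->]].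
rewrite -(semigroup_plus T HT) //.
replace (exp (- (w * s))) with (exp (w * t) * exp (- (w * (s + t)))).
2: rewrite -exp_plus; f_equal; ring.
rewrite Rmult_assoc. apply Rmult_le_compat_l; first apply Rlt_le, exp_pos.
apply (proj1 (renorm_lub x)). exists (s + t); split; [lra | easy].
Qed.

(** Dissipativity of the bounded operator [(T t - 1) / t]: solved for [y], the
    argument of the norm on the right shows [y] as a weighted mean of that vector
    and of [T t y]. *)
Lemma renorm_difference_quotient (t h : R) (y : H) :
  0 < t -> w * t <= / 2 -> 0 <= h ->
  (1 - 2 * w * h) * renorm y
  <= renorm (minus y (scal (RtoC h) (scal (RtoC (/ t)) (minus (T t y) y)))).
Proof.
intros Ht Hwt Hh.
set (u := minus y (scal (RtoC h) (scal (RtoC (/ t)) (minus (T t y) y)))).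
assert (Ey : y = scal (RtoC (/ (1 + h / t))) (plus u (scal (RtoC (h * / t)) (T t y)))).
{ assert (E : plus u (scal (RtoC (h * / t)) (T t y)) = scal (RtoC (1 + h * / t)) y).
  { unfold u. vector_ring. }
  rewrite E. unfold Rdiv. clear u E.
  transitivity (scal (RtoC (/ (1 + h * / t) * (1 + h * / t))) y).
  - rewrite Rinv_l; first vector_ring.
    assert (0 < / t) by (by apply Rinv_0_lt_compat). nra.
  - rewrite RtoC_mult. vector_ring. }
assert (Hht : 0 <= h / t) by (by apply Rdiv_le_0_compat).
assert (H1 : renorm y <= / (1 + h / t) * (renorm u + h / t * (exp (w * t) * renorm y))).
{ rewrite {1}Ey. apply Rle_trans with (1 := renorm_scal _ _).
  assert (Hi : 0 < / (1 + h / t)) by (apply Rinv_0_lt_compat; lra).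
  rewrite Rabs_right; last lra.
  apply Rmult_le_compat_l; first lra.
  apply Rle_trans with (1 := renorm_plus _ _). apply Rplus_le_compat_l.
  apply Rle_trans with (1 := renorm_scal _ _). rewrite Rabs_right; last (unfold Rdiv in Hht; lra).
  apply Rmult_le_compat_l; [exact Hht | apply renorm_semigroup; lra]. }
apply Rmult_le_compat_l with (r := 1 + h / t) in H1; last lra.
rewrite -Rmult_assoc Rinv_r in H1; last lra.
assert (He := exp_le_1_2 (w * t) ltac:(split; nra)).
assert (Hy : 0 <= renorm y) by (apply Rle_trans with (2 := norm_le_renorm y); apply norm_ge_0).
assert (H2 : h / t * (exp (w * t) * renorm y) <= h / t * ((1 + 2 * (w * t)) * renorm y)).
{ apply Rmult_le_compat_l; first exact Hht. by apply Rmult_le_compat_r. }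
replace (h / t * ((1 + 2 * (w * t)) * renorm y)) with (h / t * renorm y + 2 * w * h * renorm y) in H2
  by (field; lra).
lra.
Qed.

(** * The implicit Euler scheme *)

(** [J = (1 - h A)^-1], one step of size [h] of the implicit Euler scheme for
    [u' = A u]. *)
Definition euler_step (h : R) (J : H -> H) : Prop :=
  is_linear J /\
  forall y x, J y = x <-> exists z, generator T x z /\ y = minus x (scal (RtoC h) z).

Lemma renorm_ge_0 (x : H) : 0 <= renorm x.
Proof. apply Rle_trans with (2 := norm_le_renorm x); apply norm_ge_0. Qed.

Lemma renorm_minus (x y : H) : renorm (minus x y) <= renorm x + renorm y.
Proof.
assert (E : minus x y = plus x (scal (RtoC (Ropp 1)) y)).
{ rewrite RtoC_opp. vector_ring. }
rewrite E. apply Rle_trans with (1 := renorm_plus _ _).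
apply Rplus_le_compat_l, Rle_trans with (1 := renorm_scal _ _).
rewrite Rabs_Ropp Rabs_R1. lra.
Qed.

(** Stability of the Euler step: the limit of [renorm_difference_quotient] as the
    difference quotients converge to the generator. *)
Lemma renorm_euler_step (h : R) (J : H -> H) (y : H) :
  0 < h -> euler_step h J -> (1 - 2 * w * h) * renorm (J y) <= renorm y.
Proof.
intros Hh [HJ Hchar].
destruct (proj1 (Hchar y (J y)) eq_refl) as [z [Hz Hy]].
set (x := J y) in *. clearbody x.
apply le_epsilon => eps Heps.
assert (Hd : 0 < eps / (h * M)) by (apply Rdiv_lt_0_compat; nra).
destruct (generator_near_0 x z _ Hz Hd) as [d [Hd0 Hnear]].
set (t := Rmin (d / 2) (/ (2 * (w + 1)))).
assert (Ht : 0 < t) by (apply Rmin_pos; [lra | apply Rinv_0_lt_compat; lra]).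
assert (Htd : t < d) by (generalize (Rmin_l (d / 2) (/ (2 * (w + 1)))); fold t; lra).
assert (Hwt : w * t <= / 2).
{ apply Rle_trans with (w * / (2 * (w + 1))).
  - apply Rmult_le_compat_l; [exact Hw | apply Rmin_r].
  - rewrite Rinv_mult. apply Rle_trans with ((w + 1) * (/ 2 * / (w + 1))).
    + apply Rmult_le_compat_r; [|lra].
      assert (0 < / (w + 1)) by (apply Rinv_0_lt_compat; lra). nra.
    + apply Req_le. field. lra. }
apply Rle_trans with (1 := renorm_difference_quotient t h x Ht Hwt (Rlt_le _ _ Hh)).
set (b := scal (RtoC (/ t)) (minus (T t x) x)).
assert (Eb : minus x (scal (RtoC h) b) = minus y (scal (RtoC h) (minus b z))).
{ rewrite Hy. clearbody b. vector_ring. }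
rewrite Eb. apply Rle_trans with (1 := renorm_minus _ _).
apply Rplus_le_compat_l, Rle_trans with (1 := renorm_scal _ _).
rewrite Rabs_right; last lra.
apply Rle_trans with (h * (M * (eps / (h * M)))).
- apply Rmult_le_compat_l; first lra.
  apply Rle_trans with (1 := renorm_le_norm _).
  apply Rmult_le_compat_l; first lra. apply Rlt_le, Hnear. lra.
- apply Req_le. field. lra.
Qed.

Lemma renorm_euler_iter (h : R) (J : H -> H) (n : nat) (y : H) :
  0 < h -> 2 * w * h < 1 -> euler_step h J ->
  (1 - 2 * w * h) ^ n * renorm (Nat.iter n J y) <= renorm y.
Proof.
intros Hh Hwh HJ; induction n as [|n IH]; first by simpl; lra.
apply Rle_trans with (2 := IH). simpl.
rewrite (Rmult_comm (1 - _)) Rmult_assoc.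
apply Rmult_le_compat_l; first (apply pow_le; lra).
by apply renorm_euler_step.
Qed.

Lemma norm_euler_iter (h : R) (J : H -> H) (n : nat) (y : H) :
  0 < h -> 2 * w * h < 1 -> euler_step h J ->
  (1 - 2 * w * h) ^ n * norm (Nat.iter n J y) <= M * norm y.
Proof.
intros Hh Hwh HJ.
apply Rle_trans with (2 := renorm_le_norm y).
apply Rle_trans with (2 := renorm_euler_iter h J n y Hh Hwh HJ).
apply Rmult_le_compat_l; [apply pow_le; lra | apply norm_le_renorm].
Qed.

Lemma semigroup_sum_increment (t : R) (x : H) (n : nat) : 0 <= t ->
  minus (T t (sum_n (fun k => T (INR k * t) x) n)) (sum_n (fun k => T (INR k * t) x) n)
  = minus (T (INR (S n) * t) x) x.
Proof.
intros Ht. assert (HTt := semigroup_linear T HT t Ht).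
assert (Hs : forall k, T t (T (INR k * t) x) = T (INR (S k) * t) x).
{ intros k. rewrite -(semigroup_plus T HT) //; last by apply Rmult_le_pos; [apply pos_INR|].
  f_equal. rewrite S_INR. ring. }
induction n as [|n IH].
- rewrite !sum_O Hs. by rewrite Rmult_0_l (semigroup_0 T HT).
- rewrite !sum_Sn (lin_plus _ HTt) Hs.
  transitivity (plus (minus (T t (sum_n (fun k => T (INR k * t) x) n))
    (sum_n (fun k => T (INR k * t) x) n))
    (minus (T (INR (S (S n)) * t) x) (T (INR (S n) * t) x))).
  + vector_ring.
  + rewrite IH. vector_ring.
Qed.

Lemma average_near (u : nat -> H) (x : H) (n : nat) (eps : R) :
  (forall k, (k <= n)%nat -> norm (minus (u k) x) <= eps) ->
  norm (minus (scal (RtoC (/ INR (S n))) (sum_n u n)) x) <= eps.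
Proof.
intros Hu.
assert (Hn : 0 < INR (S n)) by (apply lt_0_INR; lia).
assert (Hi : 0 < / INR (S n)) by (by apply Rinv_0_lt_compat).
assert (Hsum : sum_n (fun k => minus (u k) x) n = minus (sum_n u n) (scal (RtoC (INR (S n))) x)).
{ clear Hu Hn Hi. induction n as [|n IH].
  - rewrite !sum_O INR_1. vector_ring.
  - rewrite !sum_Sn IH (S_INR (S n)). vector_ring. }
assert (E : minus (scal (RtoC (/ INR (S n))) (sum_n u n)) x
  = scal (RtoC (/ INR (S n))) (sum_n (fun k => minus (u k) x) n)).
{ rewrite Hsum. generalize (sum_n u n) as s => s.
  vector_expand. rewrite RtoC_inv; last lra. field. apply RtoC_neq0; lra. }
rewrite E norm_scal_R Rabs_right; last lra.
apply Rle_trans with (/ INR (S n) * (eps * INR (S n))); last (apply Req_le; field; lra).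
apply Rmult_le_compat_l; first lra.
apply Rle_trans with (1 := vnorm_sum _ _). rewrite -sum_cte. by apply sum_Rle.
Qed.

(** The average [a] of an orbit over a short time [eta] has a bounded difference
    quotient, so dissipativity in the equivalent norm brings it close to the Euler
    step [J x]; it is also close to [x]. *)
Lemma euler_step_near_identity (x : H) (eps : R) : 0 < eps ->
  exists h0, 0 < h0 /\ forall h J, 0 < h < h0 -> euler_step h J -> norm (minus (J x) x) <= eps.
Proof.
intros Heps.
(* The average contributes [e] and its distance to [J x] at most [6 M e]. *)
set (e := eps / (6 * M + 1)).
assert (He : 0 < e) by (apply Rdiv_lt_0_compat; lra).
destruct (semigroup_near_0 x e He) as [d [Hd Hnear]].
set (eta := Rmin (d / 2) (/ (4 * (w + 1)))).
assert (Hi : 0 < / (w + 1)) by (apply Rinv_0_lt_compat; lra).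
assert (Heta : 0 < eta).
{ apply Rmin_pos; [lra | apply Rinv_0_lt_compat; lra]. }
assert (Hetad : eta < d) by (generalize (Rmin_l (d / 2) (/ (4 * (w + 1)))); fold eta; lra).
assert (Hweta : w * eta <= / 4).
{ assert (Hr := Rmin_r (d / 2) (/ (4 * (w + 1)))). fold eta in Hr.
  rewrite Rinv_mult in Hr.
  assert (Hwi : (w + 1) * / (w + 1) = 1) by (apply Rinv_r; lra).
  nra. }
exists eta; split; first exact Heta.
intros h J Hh [HJ Hchar].
destruct (proj1 (Hchar x (J x)) eq_refl) as [z [Hz Hx]].
set (y := J x) in *. clearbody y.
destruct (generator_near_0 y z (e / h) Hz) as [d' [Hd' Hgen]].
{ apply Rdiv_lt_0_compat; lra. }
destruct (archimed_cor1 (d' / eta)) as [m [Hm Hm0]].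
{ apply Rdiv_lt_0_compat; lra. }
destruct m as [|m]; first lia.
assert (HSm : 1 <= INR (S m)) by (rewrite S_INR; generalize (pos_INR m); lra).
assert (HSmi : 0 < / INR (S m)) by (apply Rinv_0_lt_compat; lra).
set (t := eta * / INR (S m)).
assert (Ht : 0 < t) by (by apply Rmult_lt_0_compat).
assert (Htd : t < d').
{ apply Rmult_lt_compat_l with (r := eta) in Hm; last exact Heta.
  replace (eta * (d' / eta)) with d' in Hm by (field; lra). exact Hm. }
assert (Hteta : t <= eta).
{ assert (/ INR (S m) <= 1); [rewrite -Rinv_1; apply Rinv_le_contravar; lra|].
  unfold t. nra. }
assert (HmT : INR (S m) * t = eta) by (unfold t; field; lra).
set (s := sum_n (fun k => T (INR k * t) x) m).
set (a := scal (RtoC (/ INR (S m))) s).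
assert (Ha : norm (minus a x) <= e).
{ apply average_near => k Hk. apply Rlt_le, Hnear. split.
  - apply Rmult_le_pos; [apply pos_INR | lra].
  - apply Rle_lt_trans with (2 := Hetad). rewrite -HmT.
    apply Rmult_le_compat_r; [lra | apply le_INR; lia]. }
assert (Hinc : minus (T t a) a = scal (RtoC (/ INR (S m))) (minus (T eta x) x)).
{ unfold a. rewrite (lin_scal _ (semigroup_linear T HT t (Rlt_le _ _ Ht))).
  rewrite -HmT -semigroup_sum_increment; last lra. fold s. clearbody s. vector_ring. }
set (v := minus y a).
assert (Hv : (1 - 2 * w * h) * renorm v <= M * e + (M * e + M * e)).
{ apply Rle_trans with (1 := renorm_difference_quotient t h v Ht ltac:(nra) ltac:(lra)).
  assert (Ev : minus v (scal (RtoC h) (scal (RtoC (/ t)) (minus (T t v) v)))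
    = plus (minus x a) (plus
       (scal (RtoC h) (minus z (scal (RtoC (/ t)) (minus (T t y) y))))
       (scal (RtoC (h / eta)) (minus (T eta x) x)))).
  { unfold v. rewrite (lin_minus _ (semigroup_linear T HT t (Rlt_le _ _ Ht))).
    assert (Ea : T t a = plus a (scal (RtoC (/ INR (S m))) (minus (T eta x) x))).
    { rewrite -Hinc. generalize (T t a) as b => b. clearbody a. vector_ring. }
    rewrite Ea. clearbody a.
    assert (Eh : / t * / INR (S m) = / eta) by (rewrite -HmT; field; lra).
    assert (Ehe : h / eta = h * (/ t * / INR (S m))) by (rewrite Eh; easy).
    rewrite Ehe. generalize (T t y) (T eta x) => p q.
    generalize (/ t) (/ INR (S m)) => b c. rewrite Hx. vector_ring. }
  rewrite Ev. clear Ev.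
  apply Rle_trans with (1 := renorm_plus _ _). apply Rplus_le_compat.
  { apply Rle_trans with (1 := renorm_le_norm _). apply Rmult_le_compat_l; first lra.
    assert (E : minus x a = opp (minus a x)) by (clearbody a; vector_ring).
    by rewrite E vnorm_opp. }
  apply Rle_trans with (1 := renorm_plus _ _). apply Rplus_le_compat.
  - apply Rle_trans with (1 := renorm_scal _ _). rewrite Rabs_right; last lra.
    apply Rle_trans with (h * (M * (e / h))); last (apply Req_le; field; lra).
    apply Rmult_le_compat_l; first lra.
    apply Rle_trans with (1 := renorm_le_norm _). apply Rmult_le_compat_l; first lra.
    set (b := scal (RtoC (/ t)) (minus (T t y) y)).
    assert (E : minus z b = opp (minus b z)) by (clearbody b; vector_ring).
    rewrite E vnorm_opp. apply Rlt_le, Hgen. lra.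
  - apply Rle_trans with (1 := renorm_scal _ _).
    assert (Hhe : 0 <= h / eta <= 1).
    { split; first by apply Rdiv_le_0_compat; lra.
      apply Rmult_le_reg_r with eta; first exact Heta.
      unfold Rdiv. rewrite Rmult_assoc Rinv_l; lra. }
    rewrite Rabs_right; last lra.
    assert (Hr : renorm (minus (T eta x) x) <= M * e).
    { apply Rle_trans with (1 := renorm_le_norm _). apply Rmult_le_compat_l; first lra.
      apply Rlt_le, Hnear. lra. }
    assert (Hr0 := renorm_ge_0 (minus (T eta x) x)). nra. }
assert (Hvn : norm v <= 6 * M * e).
{ apply Rle_trans with (1 := norm_le_renorm v). assert (Hr0 := renorm_ge_0 v).
  assert (Hwh : w * h <= / 4) by (apply Rle_trans with (w * eta); [apply Rmult_le_compat_l; lra | exact Hweta]).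
  assert (/ 2 * renorm v <= (1 - 2 * w * h) * renorm v) by (apply Rmult_le_compat_r; lra).
  lra. }
assert (Eyx : minus y x = plus v (minus a x)).
{ unfold v. clearbody a. vector_ring. }
rewrite Eyx. apply Rle_trans with (1 := vnorm_triangle _ _).
apply Rle_trans with (6 * M * e + e); first lra.
apply Req_le. unfold e. field. lra.
Qed.

Lemma generator_semigroup (t : R) (x z : H) :
  0 <= t -> generator T x z -> generator T (T t x) (T t z).
Proof.
intros Ht Hz.
assert (HTt := semigroup_linear T HT t Ht).
destruct (linear_norm _ HTt) as [c [Hc HTc]].
apply (filterlim_locally_ball_norm (U := H)) => eps.
assert (He : 0 < eps / c) by (apply Rdiv_lt_0_compat; [apply cond_pos | exact Hc]).
destruct (generator_near_0 x z _ Hz He) as [d [Hd Hnear]].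
exists (mkposreal d Hd) => s Hs Hs0.
assert (Hsd : 0 < s < d).
{ split; first exact Hs0.
  unfold ball in Hs; simpl in Hs; unfold AbsRing_ball, abs, minus, plus, opp in Hs; simpl in Hs.
  rewrite Rabs_right in Hs; lra. }
change (norm (minus (scal (RtoC (/ s)) (minus (T s (T t x)) (T t x))) (T t z)) < eps).
assert (E : minus (scal (RtoC (/ s)) (minus (T s (T t x)) (T t x))) (T t z)
  = T t (minus (scal (RtoC (/ s)) (minus (T s x) x)) z)).
{ rewrite !(lin_minus _ HTt) (lin_scal _ HTt) (lin_minus _ HTt).
  rewrite -!(semigroup_plus T HT); try lra. by rewrite Rplus_comm. }
rewrite E. apply Rle_lt_trans with (1 := HTc _).
apply Rlt_le_trans with (c * (eps / c)).
- apply Rmult_lt_compat_l; [exact Hc | by apply Hnear].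
- apply Req_le. field. lra.
Qed.

Lemma euler_step_semigroup (h t : R) (J : H -> H) (y : H) :
  0 <= t -> euler_step h J -> J (T t y) = T t (J y).
Proof.
intros Ht [HJ Hchar]. apply Hchar.
destruct (proj1 (Hchar y (J y)) eq_refl) as [z [Hz Hy]].
exists (T t z); split; first by apply generator_semigroup.
rewrite {1}Hy (lin_minus _ (semigroup_linear T HT t Ht)) (lin_scal _ (semigroup_linear T HT t Ht)) //.
Qed.

(** The local error is [o(h)]: as [J] commutes with the generator,
    [J x = x + h J z], and [J z] tends to [z]. *)
Lemma euler_step_consistent (x z : H) (eps : R) :
  generator T x z -> 0 < eps ->
  exists h0, 0 < h0 /\ forall h J, 0 < h < h0 -> euler_step h J ->
    norm (minus (T h x) (J x)) <= eps * h.
Proof.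
intros Hz Heps.
destruct (generator_near_0 x z (eps / 2) Hz ltac:(lra)) as [d1 [Hd1 H1]].
destruct (euler_step_near_identity z (eps / 2) ltac:(lra)) as [d2 [Hd2 H2]].
exists (Rmin d1 d2); split; first by apply Rmin_pos.
intros h J Hh HJ.
assert (Hh1 := Rmin_l d1 d2). assert (Hh2 := Rmin_r d1 d2).
assert (H1h := H1 h ltac:(lra)). assert (H2h := H2 h J ltac:(lra) HJ).
assert (Hx : minus (J x) (scal (RtoC h) (J z)) = x).
{ destruct HJ as [HJ Hchar]. rewrite -(lin_scal _ HJ) -(lin_minus _ HJ).
  apply Hchar. by exists z. }
assert (E : minus (T h x) (J x) = scal (RtoC h) (minus
  (minus (scal (RtoC (/ h)) (minus (T h x) x)) z) (minus (J z) z))).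
{ assert (ESx : J x = plus x (scal (RtoC h) (J z))).
  { rewrite -{2}Hx. generalize (J x) (J z) => p q. vector_ring. }
  rewrite ESx. generalize (T h x) (J z) => p q. vector_expand.
  rewrite RtoC_inv; last lra. field. apply RtoC_neq0; lra. }
rewrite E norm_scal_R Rabs_right; last lra.
rewrite Rmult_comm. apply Rmult_le_compat_r; first lra.
apply Rle_trans with (1 := vnorm_minus _ _).
apply Rle_trans with (eps / 2 + eps / 2); last lra.
apply Rplus_le_compat; [by apply Rlt_le | exact H2h].
Qed.

(** The errors of the [n] steps add up.  The error made at step [k] is the first
    one transported by [T (k h)], since [J] commutes with the semigroup, and later
    steps are stable. *)
Lemma euler_telescope (h e : R) (J : H -> H) (x : H) (n : nat) :
  0 < h -> 2 * w * h <= / 2 -> euler_step h J -> renorm (minus (T h x) (J x)) <= e ->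
  (1 - 2 * w * h) ^ n * renorm (minus (T (INR n * h) x) (Nat.iter n J x)) <= INR n * e.
Proof.
intros Hh Hwh HJ He.
assert (He0 : 0 <= e) by (apply Rle_trans with (1 := renorm_ge_0 _) (2 := He)).
assert (Hq : (1 - 2 * w * h) * exp (w * h) <= 1).
{ assert (Hwh0 : 0 <= w * h) by (apply Rmult_le_pos; lra).
  assert (Hb := exp_le_1_2 (w * h) ltac:(lra)). assert (Hp := exp_pos (w * h)). nra. }
induction n as [|n IH].
- simpl. rewrite Rmult_0_l (semigroup_0 T HT).
  assert (E : minus x x = scal (RtoC 0) x) by vector_ring.
  rewrite E. generalize (renorm_scal 0 x). rewrite Rabs_R0. lra.
- assert (Hnh : 0 <= INR n * h) by (apply Rmult_le_pos; [apply pos_INR | lra]).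
  assert (HTn := semigroup_linear T HT _ Hnh).
  assert (E : minus (T (INR (S n) * h) x) (Nat.iter (S n) J x)
    = plus (T (INR n * h) (minus (T h x) (J x)))
        (J (minus (T (INR n * h) x) (Nat.iter n J x)))).
  { assert (E1 := lin_minus _ HTn (T h x) (J x)).
    assert (E2 := lin_minus _ (proj1 HJ) (T (INR n * h) x) (Nat.iter n J x)).
    assert (E3 := euler_step_semigroup h (INR n * h) J x Hnh HJ).
    assert (E4 := semigroup_plus T HT (INR n * h) h x Hnh (Rlt_le _ _ Hh)).
    replace (INR n * h + h) with (INR (S n) * h) in E4 by (rewrite S_INR; ring).
    rewrite E1 E2 E3 -E4. simpl Nat.iter. vector_ring. }
  rewrite E S_INR.
  set (p := renorm (minus (T (INR n * h) x) (Nat.iter n J x))) in *.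
  assert (H1 := renorm_plus (T (INR n * h) (minus (T h x) (J x)))
     (J (minus (T (INR n * h) x) (Nat.iter n J x)))).
  assert (H2 := renorm_semigroup (INR n * h) (minus (T h x) (J x)) Hnh).
  assert (H3 := renorm_euler_step h J (minus (T (INR n * h) x) (Nat.iter n J x)) Hh HJ).
  fold p in H3.
  replace (w * (INR n * h)) with (INR n * (w * h)) in H2 by ring.
  rewrite exp_nat in H2.
  assert (Hqn : 0 < (1 - 2 * w * h) ^ n) by (apply pow_lt; lra).
  assert (Hqe : (1 - 2 * w * h) ^ n * exp (w * h) ^ n <= 1).
  { rewrite -Rpow_mult_distr. apply Rle_trans with (1 ^ n); last (rewrite pow1; lra).
    apply pow_incr; split; last exact Hq.
    apply Rmult_le_pos; [lra | apply Rlt_le, exp_pos]. }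
  assert (Hn0 : 0 <= exp (w * h) ^ n) by (apply pow_le, Rlt_le, exp_pos).
  set (q := (1 - 2 * w * h) ^ n) in *. set (g := exp (w * h) ^ n) in *.
  set (a := renorm (minus (T h x) (J x))) in *.
  assert (Ha0 : 0 <= a) by apply renorm_ge_0.
  simpl pow. fold q.
  apply Rle_trans with ((1 - 2 * w * h) * q * (renorm (T (INR n * h) (minus (T h x) (J x)))
     + renorm (J (minus (T (INR n * h) x) (Nat.iter n J x))))).
  { apply Rmult_le_compat_l; [nra | exact H1]. }
  assert (H4 : (1 - 2 * w * h) * q * renorm (T (INR n * h) (minus (T h x) (J x))) <= e).
  { apply Rle_trans with ((1 - 2 * w * h) * q * (g * a)).
    - apply Rmult_le_compat_l; [nra | exact H2].
    - assert (q * g * a <= 1 * e) by (apply Rmult_le_compat; nra).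
      assert (0 <= 2 * w * h) by nra.
      assert (0 <= q * g * a) by (apply Rmult_le_pos; nra). nra. }
  assert (H5 : q * ((1 - 2 * w * h) * renorm (J (minus (T (INR n * h) x) (Nat.iter n J x)))) <= q * p)
    by (apply Rmult_le_compat_l; lra).
  nra.
Qed.

Lemma euler_converges (x z : H) (t eps : R) :
  generator T x z -> 0 < t -> 0 < eps ->
  exists n0 : nat, forall n J, (n0 <= n)%nat -> (1 <= n)%nat -> euler_step (t / INR n) J ->
    norm (minus (T t x) (Nat.iter n J x)) <= eps.
Proof.
intros Hz Ht Heps.
set (c := exp (4 * w * t)).
assert (Hc : 0 < c) by apply exp_pos.
set (e := eps / (M * t * c)).
assert (HMtc : 0 < M * t * c) by (apply Rmult_lt_0_compat; [apply Rmult_lt_0_compat; lra | exact Hc]).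
assert (He : 0 < e) by (by apply Rdiv_lt_0_compat).
destruct (euler_step_consistent x z e Hz He) as [h0 [Hh0 Hcons]].
set (h1 := Rmin h0 (/ (4 * (w + 1)))).
assert (Hi : 0 < / (w + 1)) by (apply Rinv_0_lt_compat; lra).
assert (Hh1 : 0 < h1) by (apply Rmin_pos; [exact Hh0 | apply Rinv_0_lt_compat; lra]).
destruct (archimed_cor1 (h1 / t)) as [n0 [Hn0 Hn00]]; first by apply Rdiv_lt_0_compat.
exists n0. intros n J Hn Hn1 HJ.
assert (Hnp : 0 < INR n) by (apply lt_0_INR; lia).
set (h := t / INR n) in *.
assert (Hh : 0 < h) by (by apply Rdiv_lt_0_compat).
assert (Hhh1 : h < h1).
{ apply Rle_lt_trans with (t * / INR n0).
  - apply Rmult_le_compat_l; first lra. apply Rinv_le_contravar; [by apply lt_0_INR | by apply le_INR].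
  - apply Rmult_lt_compat_l with (r := t) in Hn0; last exact Ht.
    replace (t * (h1 / t)) with h1 in Hn0 by (field; lra). exact Hn0. }
assert (Hm1 := Rmin_l h0 (/ (4 * (w + 1)))). assert (Hm2 := Rmin_r h0 (/ (4 * (w + 1)))).
fold h1 in Hm1, Hm2.
assert (Hwh : 2 * w * h <= / 2).
{ rewrite Rinv_mult in Hm2.
  assert (Hwi : (w + 1) * / (w + 1) = 1) by (apply Rinv_r; lra). nra. }
assert (Hnt : INR n * h = t) by (unfold h; field; lra).
assert (Htel := euler_telescope h (M * (e * h)) J x n Hh Hwh HJ).
rewrite Hnt in Htel.
assert (Hr : renorm (minus (T h x) (J x)) <= M * (e * h)).
{ apply Rle_trans with (1 := renorm_le_norm _). apply Rmult_le_compat_l; first lra.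
  apply Hcons; [lra | exact HJ]. }
specialize (Htel Hr).
replace (INR n * (M * (e * h))) with (M * e * t) in Htel by (rewrite -Hnt; ring).
assert (Hexp : 1 <= (1 - 2 * w * h) ^ n * c).
{ replace c with (exp (2 * (2 * w * h)) ^ n).
  - rewrite -Rpow_mult_distr. apply Rle_trans with (1 ^ n); first (rewrite pow1; lra).
    apply pow_incr; split; first lra. apply exp_ge_inv. split; nra.
  - rewrite -exp_nat. unfold c. f_equal. rewrite -Hnt. ring. }
apply Rle_trans with (1 := norm_le_renorm _).
set (p := renorm (minus (T t x) (Nat.iter n J x))) in *.
assert (Hp : 0 <= p) by apply renorm_ge_0.
apply Rle_trans with (M * e * t * c); last (apply Req_le; unfold e; field; repeat split; lra).
apply Rmult_le_compat_r with (r := c) in Htel; last lra. nra.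
Qed.

End Semigroup.

(** * The generalized Kreiss condition for Euler steps *)

Section Kreiss.

Context {H : HilbertSpace}.
Variable T : R -> H -> H.
Variable g : R -> R.
Hypothesis g_pos : forall s : R, 0 < s -> 0 < g s.
Hypothesis g_nondecreasing : forall s t : R, 0 < s -> s <= t -> g s <= g t.
Hypothesis HKreiss : generalized_Kreiss (generator T) g.

Lemma euler_step_exists (h : R) : 0 < h -> exists J, euler_step T h J.
Proof.
intros Hh.
assert (Hi : 0 < / h) by (by apply Rinv_0_lt_compat).
destruct (proj1 HKreiss (RtoC (/ h))) as [Q [HQ Hchar]]; first by simpl.
exists (fun y => Q (scal (RtoC (/ h)) y)). split.
- split.
  + intros x y.
    assert (E : scal (RtoC (/ h)) (plus x y)
      = plus (scal (RtoC (/ h)) x) (scal (RtoC (/ h)) y)) by vector_ring.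
    rewrite E. apply (lin_plus Q HQ).
  + intros k x.
    assert (E : scal (RtoC (/ h)) (scal k x) = scal k (scal (RtoC (/ h)) x)) by vector_ring.
    rewrite E. apply (lin_scal Q HQ).
  + destruct (linear_norm _ HQ) as [c [Hc HQc]].
    exists (c * / h). split; first by apply Rmult_lt_0_compat.
    intros x. apply Rle_trans with (1 := HQc _).
    rewrite norm_scal_R Rabs_right; [apply Req_le; ring | lra].
- assert (Hcancel : forall x : H, scal (RtoC h) (scal (RtoC (/ h)) x) = x).
  { intros x. vector_expand. rewrite RtoC_inv; last lra.
    C_field. apply RtoC_neq0; lra. }
  intros y x. rewrite Hchar. split; intros [z [Hz Hy]]; exists z; (split; first exact Hz).
  + rewrite -(Hcancel y) Hy -{2}(Hcancel x). vector_ring.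
  + rewrite Hy -{2}(Hcancel z).
    generalize (scal (RtoC (/ h)) z) => v.
    vector_expand. rewrite RtoC_inv; last lra.
    C_field. apply RtoC_neq0; lra.
Qed.

(** The vector [x = J y] satisfies [y = x - h A x], so [y - z x] is [h] times
    [(1 - z) / h x - A x]: hence [x = R ((1 - z) / h, A) ((y - z x) / h)]. *)
Lemma euler_step_resolvent_bound (h r : R) (J : H -> H) (z : C) :
  0 < h -> r < 1 -> euler_step T h J -> Cmod z <= r ->
  resolvent_bound J z (g (h / (1 - r)) / h).
Proof.
intros Hh Hr [HJ Hchar] Hz y.
destruct (proj1 (Hchar y (J y)) eq_refl) as [v [Hv Hy]].
set (x := J y) in *. clearbody x.
set (lambda := Cmult (Cminus (RtoC 1) z) (RtoC (/ h))).
assert (Hi : 0 < / h) by (by apply Rinv_0_lt_compat).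
assert (Hre : Re lambda = (1 - Re z) * / h).
{ unfold lambda, Re, Cmult, Cminus; simpl. ring. }
assert (HRz : Re z <= r).
{ apply Rle_trans with (2 := Hz). apply Rle_trans with (2 := re_le_Cmod z). apply Rle_abs. }
assert (Hlow : (1 - r) * / h <= Re lambda) by (rewrite Hre; apply Rmult_le_compat_r; lra).
assert (Hpos : 0 < (1 - r) * / h) by (apply Rmult_lt_0_compat; lra).
destruct (proj1 HKreiss lambda ltac:(lra)) as [Q HQ].
assert (Hop := proj2 HKreiss lambda Q ltac:(lra) HQ).
destruct HQ as [HQ HQchar].
set (b := minus y (scal z x)).
assert (Hx : Q (scal (RtoC (/ h)) b) = x).
{ apply HQchar. exists v; split; first exact Hv.
  unfold b, lambda. rewrite Hy. vector_expand. rewrite RtoC_inv; last lra.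
  C_field. apply RtoC_neq0; lra. }
rewrite -{1}Hx. apply Rle_trans with (1 := op_norm_bound Q _ HQ).
rewrite norm_scal_R Rabs_right; last lra.
rewrite -Rmult_assoc. apply Rmult_le_compat_r; first apply norm_ge_0.
apply Rmult_le_compat_r; first lra.
apply Rle_trans with (1 := Hop).
assert (Hinv : 1 / Re lambda <= h / (1 - r)).
{ replace (h / (1 - r)) with (/ ((1 - r) * / h)) by (field; lra).
  rewrite /Rdiv Rmult_1_l. by apply Rinv_le_contravar. }
apply g_nondecreasing; last exact Hinv.
apply Rdiv_lt_0_compat; lra.
Qed.

End Kreiss.

(** * Dyadic blocks *)

Definition in_block (p k : nat) : bool := andb (Nat.leb p k) (Nat.ltb k (2 * p)).

Lemma in_block_spec (p k : nat) :
  BoolSpec (p <= k < 2 * p)%nat (~ (p <= k < 2 * p)%nat) (in_block p k).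
Proof.
unfold in_block. destruct (Nat.leb_spec p k), (Nat.ltb_spec k (2 * p)); constructor; lia.
Qed.

Lemma block_size (p K : nat) : (2 * p <= S K)%nat ->
  sum_f_R0 (fun k => if in_block p k then 1 else 0) K = INR p.
Proof.
assert (Hgen : sum_f_R0 (fun k => if in_block p k then 1 else 0) K
   = INR (Nat.min (S K) (2 * p) - Nat.min (S K) p)).
{ induction K as [|K IH].
  - simpl sum_f_R0. destruct (in_block_spec p 0) as [Hb|Hb].
    + lia.
    + replace (Nat.min 1 (2 * p) - Nat.min 1 p)%nat with 0%nat by lia. easy.
  - rewrite tech5 IH. destruct (in_block_spec p (S K)) as [Hb|Hb].
    + replace (Nat.min (S (S K)) (2 * p) - Nat.min (S (S K)) p)%nat
        with (S (Nat.min (S K) (2 * p) - Nat.min (S K) p)) by lia.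
      by rewrite S_INR.
    + rewrite Rplus_0_r. f_equal. lia. }
intros HK. rewrite Hgen. f_equal. lia.
Qed.

Lemma sum_f_R0_switch (f : nat -> nat -> R) (N K : nat) :
  sum_f_R0 (fun i => sum_f_R0 (f i) K) N = sum_f_R0 (fun k => sum_f_R0 (fun i => f i k) N) K.
Proof.
induction N as [|N IH]; first easy.
rewrite tech5 IH -sum_plus. apply sum_eq => k _. by rewrite tech5.
Qed.

(** Each [k] lies in the blocks of at most [k] values of [p], all at least
    [(k + 1) / 2]. *)
Lemma dyadic_sum_le (b : nat -> R) (N K : nat) : (forall k, 0 <= b k) ->
  sum_f_R0 (fun p => / INR p * sum_f_R0 (fun k => if in_block p k then b k else 0) K) N
  <= 2 * sum_f_R0 b K.
Proof.
intros Hb.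
rewrite (sum_eq _ (fun p => sum_f_R0 (fun k => / INR p * (if in_block p k then b k else 0)) K)).
2: intros; by rewrite sum_f_R0_scal.
rewrite sum_f_R0_switch -sum_f_R0_scal. apply sum_Rle => k _.
assert (Hk : 0 < INR (S k)) by (apply lt_0_INR; lia).
assert (Hcount : sum_f_R0 (fun p => if (Nat.ltb 0 p && Nat.leb p k)%bool then 1 else 0) N <= INR k).
{ apply Rle_trans with (INR (Nat.min N k)); last by apply le_INR; lia.
  induction N as [|N IH].
  - simpl. lra.
  - rewrite tech5. destruct (Nat.ltb_spec 0 (S N)); last lia.
    destruct (Nat.leb_spec (S N) k); simpl andb; cbv iota.
    + replace (Nat.min (S N) k) with (S (Nat.min N k)) by lia. rewrite S_INR. lra.
    + replace (Nat.min (S N) k) with (Nat.min N k) by lia. lra. }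
apply Rle_trans with (sum_f_R0 (fun p => (2 / INR (S k) * b k) *
   (if (Nat.ltb 0 p && Nat.leb p k)%bool then 1 else 0)) N).
- apply sum_Rle => p _. destruct (in_block_spec p k) as [Hp | Hp].
  + destruct (Nat.ltb_spec 0 p); last lia. destruct (Nat.leb_spec p k); last lia.
    simpl andb; cbv iota. rewrite Rmult_1_r. apply Rmult_le_compat_r; first apply Hb.
    assert (Hp0 : 0 < INR p) by (by apply lt_0_INR).
    assert (Hle : INR (S k) <= 2 * INR p).
    { replace (2 * INR p) with (INR (2 * p)) by (rewrite mult_INR; simpl; ring). apply le_INR; lia. }
    apply Rmult_le_reg_r with (INR p * INR (S k)); first by apply Rmult_lt_0_compat.
    replace (/ INR p * (INR p * INR (S k))) with (INR (S k)) by (field; lra).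
    replace (2 / INR (S k) * (INR p * INR (S k))) with (2 * INR p) by (field; lra).
    exact Hle.
  + rewrite Rmult_0_r. apply Rmult_le_pos.
    * apply Rmult_le_pos; [apply Rdiv_le_0_compat; lra | apply Hb].
    * destruct (Nat.ltb 0 p && Nat.leb p k)%bool; lra.
- rewrite sum_f_R0_scal.
  apply Rle_trans with (2 / INR (S k) * b k * INR (S k)); last (apply Req_le; field; lra).
  apply Rmult_le_compat_l.
  + apply Rmult_le_pos; [apply Rdiv_le_0_compat; lra | apply Hb].
  + rewrite S_INR. lra.
Qed.

(** * The function Lambda *)

Lemma ex_RInt_id_scal (c a b : R) : ex_RInt (fun x => x * c) a b.
Proof.
apply (ex_RInt_continuous (V := R_CompleteNormedModule)) => x _.
apply (continuous_mult (K := R_AbsRing)); [apply continuous_id | apply continuous_const].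
Qed.

(** Induction on the total drop of [q]: it is constant up to the supremum of the
    points where it has its initial value, and has a smaller drop afterwards. *)
Lemma ex_RInt_id_integer_steps (n : nat) (q : R -> Z) (a b : R) :
  a <= b -> (forall x y, a <= x -> x <= y -> y <= b -> (q y <= q x)%Z) ->
  (q a - q b <= Z.of_nat n)%Z -> ex_RInt (fun x => x * IZR (q x)) a b.
Proof.
revert q a b; induction n as [|n IH] => q a b Hab Hq Hn.
- apply ex_RInt_ext with (2 := ex_RInt_id_scal (IZR (q a)) a b) => x Hx.
  rewrite Rmin_left // Rmax_right // in Hx.
  do 2 f_equal. assert (H1 := Hq a x). assert (H2 := Hq x b).
  assert (q x <= q a)%Z by (apply H1; lra). assert (q b <= q x)%Z by (apply H2; lra). lia.
- destruct (completeness (fun x => a <= x <= b /\ q x = q a)) as [c [Hc1 Hc2]].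
  { exists b. intros x [Hx _]. apply Hx. }
  { exists a. split; [lra | easy]. }
  assert (Hac : a <= c) by (apply Hc1; split; [lra | easy]).
  assert (Hcb : c <= b) by (apply Hc2; intros x [Hx _]; apply Hx).
  apply ex_RInt_Chasles with c.
  + apply ex_RInt_ext with (2 := ex_RInt_id_scal (IZR (q a)) a c) => x Hx.
    rewrite Rmin_left // Rmax_right // in Hx.
    do 2 f_equal. apply Z.le_antisymm; last by apply Hq; lra.
    apply NNPP => Hlt.
    assert (c <= x); last lra.
    apply Hc2. intros y [Hy Hqy]. apply Rnot_lt_le => Hxy. apply Hlt.
    rewrite -Hqy. apply Hq; lra.
  + destruct (Req_dec c b) as [<- | Hcb'].
    { apply ex_RInt_point. }
    assert (Hlast : forall x, c < x -> x <= b -> (q x <= q a - 1)%Z).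
    { intros x Hx Hxb. assert (q x <= q a)%Z by (apply Hq; lra).
      assert (q x <> q a); last lia.
      intros E. assert (x <= c); last lra. apply Hc1. split; [lra | exact E]. }
    (* Lowering the value at [c] removes the first jump. *)
    set (q' := fun x => match Rle_dec x c with left _ => (q a - 1)%Z | right _ => q x end).
    apply ex_RInt_ext with (fun x => x * IZR (q' x)).
    { intros x Hx. rewrite Rmin_left // Rmax_right // in Hx.
      unfold q'. destruct (Rle_dec x c); [lra | easy]. }
    apply IH; [exact Hcb | |].
    * intros x y Hx Hxy Hy. unfold q'.
      destruct (Rle_dec x c), (Rle_dec y c); try lra; try lia.
      -- apply Hlast; lra.
      -- apply Hq; lra.
    * unfold q'. destruct (Rle_dec c c); last lra. destruct (Rle_dec b c); lra || lia.
Qed.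

(** A monotone function is a uniform limit of step functions: round its
    multiples down to integers. *)
Lemma ex_RInt_id_decreasing (p : R -> R) (a b : R) :
  a <= b -> (forall x y, a <= x -> x <= y -> y <= b -> p y <= p x) ->
  ex_RInt (fun x => x * p x) a b.
Proof.
intros Hab Hp.
set (cl := fun x => Rmax a (Rmin x b)).
assert (Hcl : forall x, a <= cl x <= b).
{ intros x. unfold cl. split; first apply Rmax_l.
  apply Rmax_lub; [exact Hab | apply Rmin_r]. }
assert (Hclid : forall x, a <= x <= b -> cl x = x).
{ intros x Hx. unfold cl. rewrite Rmin_left; last lra. rewrite Rmax_right; lra. }
set (q := fun (N : nat) x => Int_part (INR (S N) * p x)).
set (f := fun (N : nat) x => / INR (S N) * (cl x * IZR (q N (cl x)))).
assert (HN : forall N, 0 < INR (S N)) by (intros; apply lt_0_INR; lia).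
assert (Hint : forall N, ex_RInt (f N) a b).
{ intros N. apply (ex_RInt_scal (V := R_NormedModule)).
  apply ex_RInt_ext with (fun x => x * IZR (q N x)).
  { intros x Hx. rewrite Rmin_left // Rmax_right // in Hx. rewrite Hclid //; lra. }
  assert (Hmono : forall x y, a <= x -> x <= y -> y <= b -> (q N y <= q N x)%Z).
  { intros x y Hx Hxy Hy. unfold q.
    destruct (base_Int_part (INR (S N) * p x)) as [_ H1].
    destruct (base_Int_part (INR (S N) * p y)) as [H2 _].
    assert (H3 : INR (S N) * p y <= INR (S N) * p x).
    { apply Rmult_le_compat_l; [apply Rlt_le, HN | by apply Hp]. }
    apply Z.lt_succ_r, lt_IZR. rewrite succ_IZR. lra. }
  assert (Hd : (0 <= q N a - q N b)%Z) by (assert (Hq := Hmono a b); lra || (assert (q N b <= q N a)%Z by (apply Hq; lra); lia)).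
  apply (ex_RInt_id_integer_steps (Z.to_nat (q N a - q N b))); [exact Hab | exact Hmono | lia]. }
destruct (filterlim_RInt (V := R_CompleteNormedModule) f a b eventually _
  (fun x => cl x * p (cl x)) (fun N => RInt (f N) a b)) as [l [_ Hl]].
- intros N. apply (RInt_correct (V := R_CompleteNormedModule)), Hint.
- apply filterlim_locally => eps.
  set (m := Rmax (Rabs a) (Rabs b)).
  destruct (archimed_cor1 (eps / (m + 1))) as [n0 [Hn0 Hn00]].
  { apply Rdiv_lt_0_compat; first apply cond_pos.
    assert (H1 := Rmax_l (Rabs a) (Rabs b)). assert (H2 := Rabs_pos a). unfold m. lra. }
  exists n0 => N HNn t.
  unfold ball; simpl; unfold AbsRing_ball, abs, minus, plus, opp; simpl.
  fold (INR (S N)).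
  assert (Ef : f N t + - (cl t * p (cl t))
    = cl t * (/ INR (S N) * (IZR (q N (cl t)) - INR (S N) * p (cl t)))).
  { unfold f. field. generalize (HN N); lra. }
  change (Rabs (f N t + - (cl t * p (cl t))) < eps).
  rewrite Ef !Rabs_mult.
  assert (Hi : 0 < / INR (S N)) by (apply Rinv_0_lt_compat, HN).
  rewrite (Rabs_right (/ _)); last lra.
  assert (Hq1 : Rabs (IZR (q N (cl t)) - INR (S N) * p (cl t)) <= 1).
  { unfold q. destruct (base_Int_part (INR (S N) * p (cl t))). apply Rabs_le. lra. }
  assert (Hcm : Rabs (cl t) <= m).
  { unfold m. apply RmaxAbs; apply Hcl. }
  assert (Hin : / INR (S N) < eps / (m + 1)).
  { apply Rle_lt_trans with (2 := Hn0). apply Rinv_le_contravar; [by apply lt_0_INR | apply le_INR; lia]. }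
  assert (Hm0 : 0 <= m) by (apply Rle_trans with (2 := Hcm); apply Rabs_pos).
  apply Rle_lt_trans with (m * (/ INR (S N) * 1)).
  + apply Rmult_le_compat; [apply Rabs_pos | | exact Hcm |].
    * apply Rmult_le_pos; [lra | apply Rabs_pos].
    * apply Rmult_le_compat_l; lra.
  + apply Rle_lt_trans with ((m + 1) * / INR (S N)); first nra.
    apply Rmult_lt_compat_l with (r := m + 1) in Hin; last lra.
    replace ((m + 1) * (eps / (m + 1))) with (pos eps) in Hin by (field; lra). exact Hin.
- apply ex_RInt_ext with (fun x => cl x * p (cl x)); last by exists l.
  intros x Hx. rewrite Rmin_left // Rmax_right // in Hx. rewrite Hclid //; lra.
Qed.

Section Lambda.

Variable g : R -> R.
Hypothesis g_pos : forall s : R, 0 < s -> 0 < g s.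
Hypothesis g_nondecreasing : forall s t : R, 0 < s -> s <= t -> g s <= g t.

Lemma inv_g_squared (x y : R) : 0 < x -> x <= y -> 0 < / g y ^ 2 <= / g x ^ 2.
Proof.
intros Hx Hxy. assert (Hgx := g_pos x Hx). assert (Hgy := g_nondecreasing x y Hx Hxy).
assert (0 < g x ^ 2) by (apply pow_lt; lra).
assert (g x ^ 2 <= g y ^ 2) by (apply pow_incr; lra).
split; [apply Rinv_0_lt_compat; lra | by apply Rinv_le_contravar].
Qed.

Lemma ex_RInt_Lambda (a b : R) : 0 < a -> a <= b -> ex_RInt (fun s => s / g s ^ 2) a b.
Proof.
intros Ha Hab. apply (ex_RInt_id_decreasing (fun s => / g s ^ 2)); first exact Hab.
intros x y Hx Hxy _. apply inv_g_squared; lra.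
Qed.

Lemma Lambda_pos (t : R) : 2 < t -> 0 < Lambda g t.
Proof.
intros Ht. unfold Lambda.
assert (Hg2 := inv_g_squared t t ltac:(lra) ltac:(lra)).
apply Rlt_le_trans with (RInt (fun _ => 2 * / g t ^ 2) 2 t).
- rewrite RInt_const. change (scal ?a ?b) with (a * b).
  apply Rmult_lt_0_compat; lra.
- apply RInt_le; [lra | apply ex_RInt_const | apply ex_RInt_Lambda; lra |].
  intros x Hx. unfold Rdiv. assert (Hgx := inv_g_squared x t ltac:(lra) ltac:(lra)).
  apply Rmult_le_compat; lra.
Qed.

Lemma Lambda_cell (tau : R) (p : nat) : 0 < tau -> (1 <= p)%nat ->
  RInt (fun s => s / g s ^ 2) (INR p * tau) (INR (S p) * tau)
  <= 2 * INR p * tau ^ 2 / g (INR p * tau) ^ 2.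
Proof.
intros Htau Hp.
assert (Hp1 : 1 <= INR p) by (apply (le_INR 1); lia).
rewrite S_INR.
assert (Hpt : 0 < INR p * tau) by (apply Rmult_lt_0_compat; lra).
apply Rle_trans with (RInt (fun _ => 2 * (INR p * tau) * / g (INR p * tau) ^ 2)
   (INR p * tau) ((INR p + 1) * tau)).
- apply RInt_le; [nra | apply ex_RInt_Lambda; nra | apply ex_RInt_const |].
  intros x Hx. unfold Rdiv.
  assert (Hgx := inv_g_squared (INR p * tau) x ltac:(lra) ltac:(lra)).
  apply Rmult_le_compat; nra.
- rewrite RInt_const. change (scal ?a ?b) with (a * b). apply Req_le. unfold Rdiv. ring.
Qed.

(** [p0] is the number of the cell that contains [2]; since [tau <= 1] this cell
    starts after [1], where [g] is at least [g 1]. *)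
Lemma Lambda_le_sum (tau : R) (Q : nat) : 0 < tau <= 1 -> 2 < INR (S Q) * tau ->
  exists p0 : nat, 1 < INR p0 * tau /\
  Lambda g (INR (S Q) * tau)
  <= sum_f_R0 (fun p => if Nat.leb p0 p
       then 2 * INR p * tau ^ 2 / g (INR p * tau) ^ 2 else 0) Q.
Proof.
intros Htau HQ.
assert (Hp0 : exists p0, INR p0 * tau <= 2 < INR (S p0) * tau).
{ clear -Htau HQ. induction Q as [|Q IH].
  - exists 0%nat. simpl in HQ |- *. lra.
  - destruct (Rle_lt_dec (INR (S Q) * tau) 2) as [Hle | Hlt].
    + by exists (S Q).
    + by apply IH. }
destruct Hp0 as [p0 [Hp1 Hp2]]. exists p0.
assert (Hp0 : 1 < INR p0 * tau) by (rewrite S_INR in Hp2; lra).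
assert (Hp01 : (1 <= p0)%nat).
{ destruct p0; last lia. simpl in Hp0. lra. }
split; first exact Hp0.
assert (Hcell0 : forall p, 0 <= (if Nat.leb p0 p
       then 2 * INR p * tau ^ 2 / g (INR p * tau) ^ 2 else 0)).
{ intros p. destruct (Nat.leb_spec p0 p); last lra.
  assert (1 <= INR p) by (apply (le_INR 1); lia).
  assert (Hgp := inv_g_squared (INR p * tau) (INR p * tau) ltac:(nra) ltac:(lra)).
  assert (0 <= tau ^ 2) by apply pow2_ge_0.
  unfold Rdiv. apply Rmult_le_pos; [|lra]. nra. }
assert (Hgen : forall P, (p0 <= S P)%nat ->
  RInt (fun s => s / g s ^ 2) (INR p0 * tau) (INR (S P) * tau)
  <= sum_f_R0 (fun p => if Nat.leb p0 p
       then 2 * INR p * tau ^ 2 / g (INR p * tau) ^ 2 else 0) P).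
{ intros P HP.
  assert (Hbase : forall P', p0 = S P' ->
    RInt (fun s => s / g s ^ 2) (INR p0 * tau) (INR (S P') * tau)
  <= sum_f_R0 (fun p => if Nat.leb p0 p
       then 2 * INR p * tau ^ 2 / g (INR p * tau) ^ 2 else 0) P').
  { intros P' <-. rewrite RInt_point. by apply cond_pos_sum. }
  induction P as [|P IH]; first by apply Hbase; lia.
  destruct (Nat.eq_dec p0 (S (S P))) as [E | HneP]; first by apply Hbase.
  assert (HpP : (p0 <= S P)%nat) by lia.
  assert (HpPR : INR p0 * tau <= INR (S P) * tau)
    by (apply Rmult_le_compat_r; [lra | by apply le_INR]).
  assert (Hstep : INR (S P) * tau <= INR (S (S P)) * tau)
    by (apply Rmult_le_compat_r; [lra | apply le_INR; lia]).
  rewrite -(RInt_Chasles (V := R_CompleteNormedModule) _ (INR p0 * tau) (INR (S P) * tau)).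
  - rewrite tech5. apply Rplus_le_compat; first by apply IH.
    destruct (Nat.leb_spec p0 (S P)); last lia.
    apply Lambda_cell; [lra | lia].
  - apply ex_RInt_Lambda; lra.
  - apply ex_RInt_Lambda; lra. }
assert (Hp0Q : (p0 <= S Q)%nat).
{ apply INR_le. apply Rmult_le_reg_r with tau; lra. }
apply Rle_trans with (2 := Hgen Q Hp0Q).
unfold Lambda.
rewrite -(RInt_Chasles (V := R_CompleteNormedModule) _ (INR p0 * tau) 2 (INR (S Q) * tau)).
- change (plus ?a ?b) with (a + b).
  assert (H0 : 0 <= RInt (fun s => s / g s ^ 2) (INR p0 * tau) 2).
  { apply RInt_ge_0; [lra | apply ex_RInt_Lambda; lra |].
    intros x Hx. apply Rdiv_le_0_compat; first lra. apply pow_lt, g_pos. lra. }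
  lra.
- apply ex_RInt_Lambda; lra.
- apply ex_RInt_Lambda; lra.
Qed.

End Lambda.

(** * Growth of the powers of an Euler step *)

Lemma pow_1_minus_ge (u : R) (k : nat) :
  0 <= u <= / 2 -> INR k * u <= 1 -> 1 <= (1 - u) ^ k * exp 2.
Proof.
intros Hu Hk.
apply Rle_trans with ((1 - u) ^ k * exp (2 * u) ^ k).
- rewrite -Rpow_mult_distr. apply Rle_trans with (1 ^ k); first (rewrite pow1; lra).
  apply pow_incr; split; [lra | by apply exp_ge_inv].
- apply Rmult_le_compat_l; first (apply pow_le; lra).
  rewrite -exp_nat. destruct (Rle_lt_or_eq_dec (INR k * (2 * u)) 2) as [Hl | Hl]; first lra.
  + by apply Rlt_le, exp_increasing.
  + rewrite Hl. lra.
Qed.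

Lemma geometric_square_sum (c h : R) (N : nat) : 0 < h <= 1 ->
  sum_f_R0 (fun n => (c * (1 - h) ^ n) ^ 2) N <= c ^ 2 / h.
Proof.
intros Hh.
assert (Hp : forall n, 0 <= (1 - h) ^ n <= 1).
{ intros n; split; first (apply pow_le; lra).
  apply Rle_trans with (1 ^ n); [apply pow_incr; lra | rewrite pow1; lra]. }
assert (Hc := pow2_ge_0 c).
apply Rle_trans with (c ^ 2 * sum_f_R0 (fun n => (1 - h) ^ n) N).
- rewrite -sum_f_R0_scal. apply sum_Rle => n _. rewrite Rpow_mult_distr.
  apply Rmult_le_compat_l; first exact Hc. generalize (Hp n). nra.
- apply Rmult_le_compat_l; first exact Hc.
  rewrite tech3; last lra.
  replace (1 - (1 - h)) with h by ring.
  rewrite -[X in _ <= X]Rmult_1_l. apply Rmult_le_compat_r.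
  + apply Rlt_le, Rinv_0_lt_compat; lra.
  + generalize (Hp (S N)). lra.
Qed.

Lemma sum_n_scal_vector {H : HilbertSpace} (c : nat -> R) (y : H) (N : nat) :
  sum_n (fun n => scal (RtoC (c n)) y) N = scal (RtoC (sum_f_R0 c N)) y.
Proof.
induction N as [|N IH]; first by rewrite sum_O.
rewrite sum_Sn IH tech5. vector_ring.
Qed.

Section EulerPowers.

Context {H : HilbertSpace}.
Variable T : R -> H -> H.
Variable g : R -> R.
Hypothesis HT : C0_semigroup T.
Hypothesis g_pos : forall s : R, 0 < s -> 0 < g s.
Hypothesis g_nondecreasing : forall s t : R, 0 < s -> s <= t -> g s <= g t.
Hypothesis HKreiss : generalized_Kreiss (generator T) g.
Variables M w : R.
Hypothesis HM : 1 <= M.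
Hypothesis Hw : 0 <= w.
Hypothesis Hgrowth : forall t x, 0 <= t -> norm (T t x) <= M * exp (w * t) * norm x.

(** The abscissa of reference.  It exceeds the growth rate [2 w] of the Euler
    scheme by [1], so that the powers of [(1 - a h) J] decay like [(1 - h)^n]. *)
Let a : R := 2 * w + 1.
Let C0 : R := / g 1 ^ 2 + a ^ 2.

Variable h : R.
Variable J : H -> H.
Hypothesis Hh : 0 < h.
Hypothesis Hah : a * h <= / 2.
Hypothesis HJ : euler_step T h J.

Lemma C0_pos : 0 < C0.
Proof.
unfold C0. assert (0 < g 1) by (apply g_pos; lra).
assert (0 < / g 1 ^ 2) by (apply Rinv_0_lt_compat, pow_lt; lra).
generalize (pow2_ge_0 a). lra.
Qed.

Lemma h_bounds : h <= / 2 /\ 0 <= 2 * w * h <= / 2.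
Proof. unfold a in Hah. assert (0 <= w * h) by (apply Rmult_le_pos; lra). nra. Qed.

Lemma reference_bound (n : nat) (x : H) :
  (1 - a * h) ^ n * norm (Nat.iter n J x) <= M * (1 - h) ^ n * norm x.
Proof.
destruct h_bounds as [Hh1 Hwh].
assert (Hb := norm_euler_iter T HT M w HM Hw Hgrowth h J n x Hh ltac:(lra) HJ).
apply Rle_trans with ((1 - h) ^ n * ((1 - 2 * w * h) ^ n * norm (Nat.iter n J x))).
- rewrite -Rmult_assoc -Rpow_mult_distr. apply Rmult_le_compat_r; first apply norm_ge_0.
  apply pow_incr; split; first lra. unfold a. nra.
- apply Rle_trans with ((1 - h) ^ n * (M * norm x)); last (apply Req_le; ring).
  apply Rmult_le_compat_l; [apply pow_le; lra | exact Hb].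
Qed.

(** The circle of radius [1 - h / s] corresponds to the abscissa [1 / s] for the
    generator, and that of radius [1 - a h] to the abscissa [a], beyond the growth
    rate.  They are at most [a h] apart, and this [h] cancels the one in the resolvent
    bound [g s / h]: the constant [C0] does not depend on [h]. *)
Lemma radius_facts (s : R) : 1 <= s ->
  0 <= 1 - a * h <= 1 - h / s /\
  0 <= g s / h /\
  (forall z, Cmod z <= 1 - h / s -> resolvent_bound J z (g s / h)) /\
  power_decay J (1 - h / s) /\
  1 + (g s / h) ^ 2 * (1 - h / s - (1 - a * h)) ^ 2 <= C0 * g s ^ 2.
Proof.
intros Hs. destruct h_bounds as [Hh1 Hwh].
assert (Hgs : 0 < g s) by (apply g_pos; lra).
assert (Hhs : 0 < h / s <= h).
{ split; first (apply Rdiv_lt_0_compat; lra).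
  unfold Rdiv. assert (/ s <= 1) by (rewrite -Rinv_1; apply Rinv_le_contravar; lra). nra. }
assert (HB : 0 <= g s / h) by (apply Rdiv_le_0_compat; lra).
assert (Hres : forall z, Cmod z <= 1 - h / s -> resolvent_bound J z (g s / h)).
{ intros z Hz.
  replace s with (h / (1 - (1 - h / s))) at 1 by (field; split; lra).
  apply (euler_step_resolvent_bound T g g_nondecreasing HKreiss); auto. lra. }
assert (Hah1 : h <= a * h) by (unfold a; nra).
repeat split; try lra; auto.
- apply (resolvent_bound_power_decay J (proj1 HJ) _ (g s / h)); auto. lra.
- assert (Hd : 0 <= (g s / h) * (1 - h / s - (1 - a * h)) <= g s * a).
  { split; first (apply Rmult_le_pos; lra).
    apply Rle_trans with (g s / h * (a * h)); last (apply Req_le; field; lra).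
    apply Rmult_le_compat_l; lra. }
  rewrite -Rpow_mult_distr.
  apply Rle_trans with (/ g 1 ^ 2 * g s ^ 2 + (g s * a) ^ 2).
  + apply Rplus_le_compat; last by apply pow_incr.
    assert (Hg1 : 0 < g 1) by (apply g_pos; lra).
    assert (Hg1s : g 1 <= g s) by (apply g_nondecreasing; lra).
    apply Rmult_le_reg_l with (g 1 ^ 2); first by apply pow_lt.
    rewrite -Rmult_assoc Rinv_r; last (apply pow_nonzero; lra).
    rewrite Rmult_1_r Rmult_1_l. apply pow_incr; lra.
  + apply Req_le. unfold C0. ring.
Qed.

Let C1 : R := exp 2 ^ 2 * (8 * C0 * M ^ 4).

(** The square function estimate at time [(K + 1) h], with radius
    [1 - 1 / (K + 1)]. *)
Lemma orbit_mean_square (K : nat) (x : H) :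
  (1 <= K)%nat -> 1 <= INR (S K) * h ->
  h * sum_f_R0 (fun k => norm (Nat.iter (S k) J x) ^ 2) K
  <= C1 * g (INR (S K) * h) ^ 2 * norm x ^ 2.
Proof.
intros HK Hs. destruct h_bounds as [Hh1 Hwh].
set (n := S K) in *. set (s := INR n * h) in *.
destruct (radius_facts s Hs) as [Hrho [HB [Hres [Hdec Hfac]]]].
assert (Hn : 2 <= INR n) by (apply (le_INR 2); lia).
assert (Hr : h / s = / INR n) by (unfold s; field; lra).
set (r := 1 - h / s) in *.
assert (HSx : norm (J x) <= 2 * M * norm x).
{ assert (Hb := norm_euler_iter T HT M w HM Hw Hgrowth h J 1 x Hh ltac:(lra) HJ).
  simpl in Hb. generalize (norm_ge_0 (J x)). nra. }
assert (HE : forall N, sum_f_R0 (fun k => ((1 - a * h) ^ k * norm (Nat.iter (S k) J x)) ^ 2) N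
   <= M ^ 2 / h * (2 * M * norm x) ^ 2).
{ intros N. apply Rle_trans with (sum_f_R0 (fun k => norm (J x) ^ 2 * (M * (1 - h) ^ k) ^ 2) N).
  - apply sum_Rle => k _. rewrite -Rpow_mult_distr. apply pow_incr; split.
    + apply Rmult_le_pos; [apply pow_le; lra | apply norm_ge_0].
    + assert (Hk := reference_bound k (J x)). rewrite (iter_S_comm J) in Hk.
      change (Nat.iter (S k) J x) with (J (Nat.iter k J x)). lra.
  - rewrite sum_f_R0_scal Rmult_comm.
    assert (H0 := norm_ge_0 (J x)).
    apply Rmult_le_compat.
    + apply cond_pos_sum; intros; apply pow2_ge_0.
    + apply pow2_ge_0.
    + apply geometric_square_sum; lra.
    + apply pow_incr; lra. }
assert (Htr := orbit_transfer J (proj1 HJ) (1 - a * h) r (g s / h) _ x Hrho HB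
  (fun z Hz => Hres z (Req_le _ _ Hz)) Hdec HE K).
assert (Hlow : sum_f_R0 (fun k => norm (Nat.iter (S k) J x) ^ 2) K
  <= exp 2 ^ 2 * sum_f_R0 (fun k => (r ^ k * norm (Nat.iter (S k) J x)) ^ 2) K).
{ rewrite -sum_f_R0_scal. apply sum_Rle => k Hk.
  rewrite -Rpow_mult_distr. apply pow_incr; split; first apply norm_ge_0.
  assert (H1 : 1 <= r ^ k * exp 2).
  { unfold r. rewrite Hr. apply pow_1_minus_ge.
    - split; first (apply Rlt_le, Rinv_0_lt_compat; lra). apply Rinv_le_contravar; lra.
    - apply Rmult_le_reg_r with (INR n); first lra.
      rewrite Rmult_assoc Rinv_l; last lra. rewrite Rmult_1_r Rmult_1_l. apply le_INR. lia. }
  assert (H2 := norm_ge_0 (Nat.iter (S k) J x)). nra. }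
assert (He : 0 < exp 2 ^ 2) by (apply pow_lt, exp_pos).
apply Rle_trans with (h * (exp 2 ^ 2 * (2 * (C0 * g s ^ 2) * (M ^ 2 / h * (2 * M * norm x) ^ 2)))).
- apply Rmult_le_compat_l; first lra.
  apply Rle_trans with (1 := Hlow). apply Rmult_le_compat_l; first lra.
  apply Rle_trans with (1 := Htr). apply Rmult_le_compat_r.
  + apply Rmult_le_pos; last apply pow2_ge_0. apply Rdiv_le_0_compat; [apply pow2_ge_0 | exact Hh].
  + lra.
- apply Req_le. unfold C1. field. lra.
Qed.

Let C2 : R := 2 * C0 * M ^ 2 * exp 2 ^ 2.

(** [p J^(K+1) x] is the sum, over the block of [p], of [r^k J^k] applied to
    [r^-k J^(K+1-k) x].  Read backwards in [k], these vectors are the forcing of an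
    evolution with final value [p J^(K+1) x]; on the block the weights [r^-k] are at
    most [exp 2] because [r = 1 - 1 / (2 p)]. *)
Lemma block_estimate (K p : nat) (x : H) :
  (1 <= p)%nat -> (2 * p <= S K)%nat -> 1 <= 2 * INR p * h ->
  (INR p * norm (Nat.iter (S K) J x)) ^ 2
  <= C2 * g (2 * INR p * h) ^ 2 / h *
     sum_f_R0 (fun k => if in_block p k then norm (Nat.iter (S K - k) J x) ^ 2 else 0) K.
Proof.
intros Hp HpK Hs. destruct h_bounds as [Hh1 Hwh].
set (s := 2 * INR p * h) in *.
destruct (radius_facts s Hs) as [Hrho [HB [Hres [Hdec Hfac]]]].
assert (Hp1 : 1 <= INR p) by (apply (le_INR 1); lia).
assert (Hr : h / s = / (2 * INR p)) by (unfold s; field; lra).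
set (r := 1 - h / s) in *.
assert (Hu : 0 < / (2 * INR p) <= / 2).
{ split; [apply Rinv_0_lt_compat; lra | apply Rinv_le_contravar; lra]. }
assert (Hr0 : 0 < r) by (unfold r; lra).
set (n := S K).
set (f := fun j => if in_block p (K - j)
  then scal (RtoC (/ r ^ (K - j))) (Nat.iter (n - (K - j)) J x) else zero).
assert (Hf0 : forall j, (K < j)%nat -> f j = zero).
{ intros j Hj. unfold f. destruct (in_block_spec p (K - j)); [lia | easy]. }
assert (Hev : evolution J r f n = scal (RtoC (INR p)) (Nat.iter n J x)).
{ unfold n. rewrite (evolution_sum J (proj1 HJ)).
  rewrite -(block_size p K HpK) -(sum_f_R0_rev (fun k => if in_block p k then 1 else 0)).
  transitivity (sum_n (fun j => scal (RtoC (if in_block p (K - j) then 1 else 0))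
     (Nat.iter (S K) J x)) K).
  - apply sum_n_ext_loc => j Hj. unfold f.
    destruct (in_block_spec p (K - j)) as [Hb | Hb].
    + rewrite (iter_scal J (proj1 HJ)) -Nat.iter_add.
      replace (K - j + (n - (K - j)))%nat with (S K) by (unfold n; lia).
      generalize (Nat.iter (S K) J x) => y.
      vector_expand. rewrite RtoC_inv; last (apply pow_nonzero; lra).
      C_field.
      apply RtoC_neq0, pow_nonzero. lra.
    + assert (Hz := iter_zero J (proj1 HJ) (K - j)).
      rewrite Hz. vector_ring.
  - exact (sum_n_scal_vector (fun j => if in_block p (K - j) then 1 else 0) _ K). }
assert (Htr := evolution_transfer J (proj1 HJ) (1 - a * h) r (g s / h) (M ^ 2 / h)
  (fun k => M * (1 - h) ^ k) f K Hrho HB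
  (fun z Hz => Hres z (Req_le _ _ Hz)) Hdec reference_bound
  (fun N => geometric_square_sum M h N ltac:(lra)) Hf0).
fold n in Htr. rewrite Hev norm_scal_R Rabs_right in Htr; last lra.
apply Rle_trans with (1 := Htr).
set (F := sum_f_R0 (fun k => if in_block p k then norm (Nat.iter (n - k) J x) ^ 2 else 0) K).
assert (HF : sum_f_R0 (fun j => norm (f j) ^ 2) K <= exp 2 ^ 2 * F).
{ unfold F. rewrite -sum_f_R0_scal -(sum_f_R0_rev (fun k => exp 2 ^ 2 * _)).
  apply sum_Rle => j Hj. unfold f. destruct (in_block_spec p (K - j)) as [Hb | Hb].
  - rewrite norm_scal_R -Rpow_mult_distr.
    assert (H1 : 1 <= r ^ (K - j) * exp 2).
    { unfold r. rewrite Hr. apply pow_1_minus_ge; first lra.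
      apply Rmult_le_reg_r with (2 * INR p); first lra.
      rewrite Rmult_assoc Rinv_l; last lra.
      rewrite Rmult_1_r Rmult_1_l. replace (2 * INR p) with (INR (2 * p)) by (rewrite mult_INR; simpl; ring).
      apply le_INR. lia. }
    assert (Hpw : 0 < r ^ (K - j)) by (by apply pow_lt).
    assert (Hpi : 0 < / r ^ (K - j)) by (by apply Rinv_0_lt_compat).
    rewrite Rabs_right; last lra.
    apply pow_incr; split; first (apply Rmult_le_pos; [lra | apply norm_ge_0]).
    apply Rmult_le_compat_r; first apply norm_ge_0.
    apply Rmult_le_reg_l with (r ^ (K - j)); first exact Hpw.
    rewrite Rinv_r; lra.
  - rewrite norm_zero. simpl. lra. }
assert (HF0 : 0 <= sum_f_R0 (fun j => norm (f j) ^ 2) K) by (apply cond_pos_sum; intros; apply pow2_ge_0).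
assert (HMh : 0 <= M ^ 2 / h) by (apply Rdiv_le_0_compat; [apply pow2_ge_0 | exact Hh]).
apply Rle_trans with (2 * (C0 * g s ^ 2) * (M ^ 2 / h) * (exp 2 ^ 2 * F)).
- apply Rmult_le_compat; [| exact HF0 | | exact HF].
  + apply Rmult_le_pos; last exact HMh.
    assert (0 <= (g s / h) ^ 2 * (r - (1 - a * h)) ^ 2) by (apply Rmult_le_pos; apply pow2_ge_0). lra.
  + apply Rmult_le_compat_r; [exact HMh | lra].
- apply Req_le. unfold C2. field. lra.
Qed.

(** The block estimates, divided by [p g^2] and summed over [p]: on the left the
    sum of [Lambda_le_sum] appears, on the right [dyadic_sum_le] leaves the square
    function estimate over the whole orbit. *)
Lemma euler_power_Lambda (Q : nat) (x : H) :
  let t := INR (2 * S Q) * h in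
  2 < t ->
  Lambda g t * norm (Nat.iter (2 * S Q) J x) ^ 2
  <= 16 * C2 * C1 * g t ^ 2 * norm x ^ 2.
Proof.
intros t Ht. destruct h_bounds as [Hh1 Hwh].
set (K := (2 * Q + 1)%nat).
assert (HK : (2 * S Q)%nat = S K) by (unfold K; lia).
assert (Ett : t = INR (S Q) * (2 * h)).
{ unfold t. rewrite mult_INR. simpl (INR 2). ring. }
destruct (Lambda_le_sum g g_pos g_nondecreasing (2 * h) Q) as [p0 [Hp0 HL]]; [lra | lra |].
rewrite -Ett in HL.
set (y := norm (Nat.iter (2 * S Q) J x) ^ 2).
assert (Hy : 0 <= y) by apply pow2_ge_0.
set (b := fun k => norm (Nat.iter (S K - k) J x) ^ 2).
assert (Hb : forall k, 0 <= b k) by (intros; apply pow2_ge_0).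
assert (HC0 := C0_pos).
assert (HC2 : 0 <= C2).
{ unfold C2. apply Rmult_le_pos; [|apply pow2_ge_0]. apply Rmult_le_pos; [lra | apply pow2_ge_0]. }
apply Rle_trans with (sum_f_R0 (fun p => 8 * C2 * h *
  (/ INR p * sum_f_R0 (fun k => if in_block p k then b k else 0) K)) Q).
{ apply Rle_trans with (1 := Rmult_le_compat_r _ _ _ Hy HL).
  rewrite Rmult_comm -sum_f_R0_scal. apply sum_Rle => p HpQ.
  destruct (Nat.leb_spec p0 p) as [Hp | Hp].
  - assert (Hp0p : INR p0 * (2 * h) <= INR p * (2 * h)) by (apply Rmult_le_compat_r; [lra | by apply le_INR]).
    assert (Hp1 : (1 <= p)%nat).
    { destruct p; last lia. simpl in Hp0p. lra. }
    assert (Hp1R : 1 <= INR p) by (apply (le_INR 1); lia).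
    assert (Hbl := block_estimate K p x Hp1 ltac:(unfold K; lia) ltac:(lra)).
    rewrite -HK in Hbl.
    replace (INR p * (2 * h)) with (2 * INR p * h) by ring.
    set (s := 2 * INR p * h) in *.
    assert (Hgs : 0 < g s) by (apply g_pos; unfold s; nra).
    rewrite Rpow_mult_distr -/y HK -/b in Hbl.
    set (G := sum_f_R0 (fun k => if in_block p k then b k else 0) K) in *.
    apply Rle_trans with (8 * h ^ 2 / INR p / g s ^ 2 * (INR p ^ 2 * y)).
    + apply Req_le. field. lra.
    + apply Rle_trans with (8 * h ^ 2 / INR p / g s ^ 2 * (C2 * g s ^ 2 / h * G)).
      * apply Rmult_le_compat_l; last exact Hbl.
        apply Rdiv_le_0_compat; last by apply pow_lt.
        apply Rdiv_le_0_compat; last lra. generalize (pow2_ge_0 h). lra.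
      * apply Req_le. field. repeat split; lra.
  - rewrite Rmult_0_r.
    apply Rmult_le_pos; first by (apply Rmult_le_pos; lra).
    destruct p as [|p].
    + rewrite (sum_eq _ (fun _ => 0)).
      * rewrite sum_cte. lra.
      * intros k _. destruct (in_block_spec 0 k); [lia | easy].
    + apply Rmult_le_pos.
      * apply Rlt_le, Rinv_0_lt_compat, lt_0_INR. lia.
      * apply cond_pos_sum => k. destruct (in_block (S p) k); [apply Hb | lra]. }
rewrite sum_f_R0_scal.
assert (Hdy := dyadic_sum_le b Q K Hb).
assert (Hmean := orbit_mean_square K x ltac:(unfold K; lia)).
rewrite -HK in Hmean. fold t in Hmean. specialize (Hmean ltac:(lra)).
assert (Erev : sum_f_R0 b K = sum_f_R0 (fun k => norm (Nat.iter (S k) J x) ^ 2) K).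
{ rewrite -(sum_f_R0_rev b). apply sum_eq => k Hk. unfold b. do 3 f_equal. lia. }
rewrite Erev in Hdy.
apply Rle_trans with (8 * C2 * h * (2 * sum_f_R0 (fun k => norm (Nat.iter (S k) J x) ^ 2) K)).
- apply Rmult_le_compat_l; [|exact Hdy]. apply Rmult_le_pos; lra.
- apply Rle_trans with (16 * C2 * (h * sum_f_R0 (fun k => norm (Nat.iter (S k) J x) ^ 2) K)).
  + apply Req_le. ring.
  + apply Rle_trans with (16 * C2 * (C1 * g t ^ 2 * norm x ^ 2)); last (apply Req_le; ring).
    apply Rmult_le_compat_l; [lra | exact Hmean].
Qed.

End EulerPowers.

Theorem theorem2p1 (H : HilbertSpace) (T : R -> H -> H) (g : R -> R)
  (HT : C0_semigroup T)
  (g_pos : forall s : R, 0 < s -> 0 < g s)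
  (g_nondecreasing : forall s t : R, 0 < s -> s <= t -> g s <= g t)
  (HKreiss : generalized_Kreiss (generator T) g) :
  bigO_infty (fun t => op_norm (T t)) (fun t => g t / sqrt (Lambda g t)).
Proof.
destruct (semigroup_exponential_bound T HT) as [M [w [HM [Hw Hgrowth]]]].
set (h0 := / 2 / (2 * w + 1)).
assert (Hh0 : 0 < h0) by (apply Rdiv_lt_0_compat; lra).
assert (Hpow : exists C, forall h J Q x, 0 < h <= h0 -> euler_step T h J ->
  2 < INR (2 * S Q) * h ->
  Lambda g (INR (2 * S Q) * h) * norm (Nat.iter (2 * S Q) J x) ^ 2
  <= C * g (INR (2 * S Q) * h) ^ 2 * norm x ^ 2).
{ eexists. intros h J Q x Hh HJ Ht.
  apply (euler_power_Lambda T g HT g_pos g_nondecreasing HKreiss M w HM Hw Hgrowth h J);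
    [lra | | exact HJ | exact Ht].
  apply Rle_trans with ((2 * w + 1) * h0); first (apply Rmult_le_compat_l; lra).
  apply Req_le. unfold h0. field. lra. }
destruct Hpow as [C Hpow].
exists (sqrt (Rmax C 1)). split.
{ apply sqrt_lt_R0. generalize (Rmax_r C 1). lra. }
exists 2. intros t Ht.
assert (HL := Lambda_pos g g_pos g_nondecreasing t Ht).
assert (Hg : 0 < g t) by (apply g_pos; lra).
assert (HsL : 0 < sqrt (Lambda g t)) by (by apply sqrt_lt_R0).
assert (HsC : 0 < sqrt (Rmax C 1)) by (apply sqrt_lt_R0; generalize (Rmax_r C 1); lra).
set (G := sqrt (Rmax C 1) * (g t / sqrt (Lambda g t))).
assert (HG : 0 < G) by (apply Rmult_lt_0_compat; [exact HsC | by apply Rdiv_lt_0_compat]).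
assert (HTt := semigroup_linear T HT t ltac:(lra)).
assert (Hiter : forall J Q x, euler_step T (t / INR (2 * S Q)) J ->
   t / INR (2 * S Q) <= h0 ->
   norm (Nat.iter (2 * S Q) J x) <= G * norm x).
{ intros J Q x HJ Hle.
  assert (Hn : 0 < INR (2 * S Q)) by (apply lt_0_INR; lia).
  assert (Hh : 0 < t / INR (2 * S Q)) by (apply Rdiv_lt_0_compat; lra).
  assert (Et : INR (2 * S Q) * (t / INR (2 * S Q)) = t) by (field; lra).
  assert (Hp := Hpow _ J Q x (conj Hh Hle) HJ).
  rewrite Et in Hp. specialize (Hp Ht).
  set (y := norm (Nat.iter (2 * S Q) J x)) in *.
  assert (Hx := norm_ge_0 x).
  apply Rsqr_incr_0_var; last (apply Rmult_le_pos; lra).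
  rewrite !Rsqr_pow2.
  apply Rmult_le_reg_l with (Lambda g t); first exact HL.
  apply Rle_trans with (1 := Hp).
  apply Rle_trans with (Rmax C 1 * g t ^ 2 * norm x ^ 2).
  - apply Rmult_le_compat_r; first apply pow2_ge_0.
    apply Rmult_le_compat_r; [apply pow2_ge_0 | apply Rmax_l].
  - apply Req_le. unfold G.
    assert (E1 : sqrt (Lambda g t) ^ 2 = Lambda g t) by (apply pow2_sqrt; lra).
    assert (E2 : sqrt (Rmax C 1) ^ 2 = Rmax C 1) by (apply pow2_sqrt; generalize (Rmax_r C 1); lra).
    rewrite -{1}E2 -{1}E1. field. lra. }
assert (Hdom : forall x z, generator T x z -> norm (T t x) <= G * norm x).
{ intros x z Hz. apply le_epsilon => eps Heps.
  destruct (euler_converges T HT M w HM Hw Hgrowth x z t eps Hz ltac:(lra) Heps) as [n0 Hn0].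
  destruct (INR_archimed h0 t Hh0) as [n1 Hn1].
  set (Q := (n0 + n1)%nat).
  assert (Hn : 0 < INR (2 * S Q)) by (apply lt_0_INR; lia).
  destruct (euler_step_exists T g HKreiss (t / INR (2 * S Q))) as [J HJ].
  { apply Rdiv_lt_0_compat; lra. }
  assert (Hle : t / INR (2 * S Q) <= h0).
  { apply Rmult_le_reg_r with (INR (2 * S Q)); first exact Hn.
    unfold Rdiv. rewrite Rmult_assoc Rinv_l; last lra. rewrite Rmult_1_r.
    apply Rle_trans with (INR n1 * h0); first lra.
    rewrite Rmult_comm. apply Rmult_le_compat_l; first lra. apply le_INR. unfold Q. lia. }
  assert (Hc := Hn0 (2 * S Q)%nat J ltac:(unfold Q; lia) ltac:(lia) HJ).
  assert (Hi := Hiter J Q x HJ Hle).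
  apply Rle_trans with (1 := vnorm_split _ _ (Nat.iter (2 * S Q) J x)). lra. }
apply op_norm_le; [exact HTt | lra |].
intros x. destruct (linear_norm _ HTt) as [c [Hc HTc]].
apply le_epsilon => eps Heps.
assert (Hd : 0 < eps / (c + G)) by (apply Rdiv_lt_0_compat; lra).
destruct (euler_step_near_identity T HT M w HM Hw Hgrowth x _ Hd) as [h1 [Hh1 Hnear]].
destruct (euler_step_exists T g HKreiss (h1 / 2)) as [J HJ]; first lra.
assert (Hx := Hnear (h1 / 2) J ltac:(lra) HJ).
destruct (proj1 (proj2 HJ x (J x)) eq_refl) as [z [Hz _]].
assert (Hy := Hdom _ _ Hz).
set (d := minus (J x) x) in *.
assert (E : T t x = minus (T t (J x)) (T t d)).
{ unfold d. rewrite (lin_minus _ HTt). vector_ring. }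
rewrite E. apply Rle_trans with (1 := vnorm_minus _ _).
assert (H1 := HTc d).
assert (H2 : norm (J x) <= norm d + norm x) by apply vnorm_split.
assert (H3 : (c + G) * norm d <= eps).
{ apply Rle_trans with ((c + G) * (eps / (c + G))); last (apply Req_le; field; lra).
  apply Rmult_le_compat_l; lra. }
apply Rle_trans with (G * (norm d + norm x) + c * norm d); last lra.
apply Rplus_le_compat; last exact H1.
apply Rle_trans with (1 := Hy). apply Rmult_le_compat_l; lra.
Qed.
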